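(* Let $\Psi(x,y)=H(x,y)+f_1(x)+f_2(y)$ on $\mathbb{R}^n\times\mathbb{R}^m$ be semi-algebraic and such that Assumption A (stated in the context) holds. Let $\{z_k\}=\{(x_k,y_k)\}$ be a bounded sequence generated by the sPALM algorithm (described in the context). Then the sequence $\{z_k\}$ has finite length, that is $\sum_{k=1}^\infty\|z_{k+1}-z_k\|<\infty$, and it converges to a critical point $z^*$ of $\Psi$.
   Context: Problem: $\min_{x,y}\Psi(x,y)$ with $\Psi(x,y)=H(x,y)+f_1(x)+f_2(y)$, $x\in\mathbb{R}^n$, $y\in\mathbb{R}^m$. Put $\Psi_1(x,y)=H(x,y)+f_1(x)$ and $\Psi_2(x,y)=H(x,y)+f_2(y)$. $\|\cdot\|$, $\|\cdot\|_2$ denote the Euclidean norm. **Assumption A.** (A1) $f_1:\mathbb{R}^n\to(-\infty,+\infty]$ and $f_2:\mathbb{R}^m\to(-\infty,+\infty]$ are proper and lower semicontinuous, with $\inf_{\mathbb{R}^n} f_1>-\infty$ and $\inf_{\mathbb{R}^m} f_2>-\infty$. (A2) $H:\mathbb{R}^n\times\mathbb{R}^m\to\mathbb{R}$ is continuously differentiable and $\inf\Psi>-\infty$. (A3) $\nabla H$ is Lipschitz continuous on bounded subsets of $\mathbb{R}^n\times\mathbb{R}^m$. (A4) The partial gradients are globally Lipschitz: for each fixed $y$ there is $L_1'(y)\ge0$ with $\|\nabla_xH(u,y)-\nabla_xH(v,y)\|_2\le L_1'(y)\|u-v\|_2$ for all $u,v\in\mathbb{R}^n$; for each fixed $x$ there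 is $L_2'(x)\ge 0$ with $\|\nabla_yH(x,u)-\nabla_yH(x,v)\|_2\le L_2'(x)\|u-v\|_2$ for all $u,v\in\mathbb{R}^m$. The smallest such constants are denoted $L_1(y)$, $L_2(x)$. (A5) There exist $\lambda_1^+,\lambda_2^+>0$ such that, along the generated iterates, $\sup_k L_1(y_k)\le\lambda_1^+$ and $\sup_kL_2(x_k)\le\lambda_2^+$. **Proximal map.** For a lower semicontinuous $\sigma$ and $t>0$, $\mathrm{prox}_t^\sigma(x)=\operatorname{argmin}_w\{\sigma(w)+\frac t2\|w-x\|^2\}$ (possibly multi-valued; in the algorithm the new iterate is any element). **sPALM.** Input: $(x_0,y_0)\in\mathbb{R}^n\times\mathbb{R}^m$, $\rho_1,\delta_1,\rho_2,\delta_2\in(0,1)$, $0<\alpha_{\min}\le\alpha_{\max}$, $\alpha_{0,1},\alpha_{0,2}\in[\alpha_{\min},\alpha_{\max}]$. For $k=0,1,\dots$: 1. $x_{k+1}\in\mathrm{prox}^{f_1}_{1/\bar\alpha_{k,1}}\big(x_k-\bar\alpha_{k,1}\nabla_xH(x_k,y_k)\big)$, where $\bar\alpha_{k,1}=\rho_1^{i_k}\alpha_{k,1}$ and $i_k$ is the smallest nonnegative integer for which $\Psi_1(x_{k+1},y_k)\le\Psi_1(x_k,y_k)-\frac{\delta_1}{2\bar\alpha_{k,1}}\|x_{k+1}-x_k\|_2^2$. 2. Compute $\alpha_{k+1,1}\in[\alpha_{\min},\alpha_{\max}]$ by the spectral rule below with $s_{k,1}=x_{k+1}-x_k$, $g_{k,1}=\nabla_xH(x_{k+1},y_k)-\nabla_xH(x_k,y_k)$.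 3. $y_{k+1}\in\mathrm{prox}^{f_2}_{1/\bar\alpha_{k,2}}\big(y_k-\bar\alpha_{k,2}\nabla_yH(x_{k+1},y_k)\big)$, where $\bar\alpha_{k,2}=\rho_2^{j_k}\alpha_{k,2}$ and $j_k$ is the smallest nonnegative integer for which $\Psi_2(x_{k+1},y_{k+1})\le\Psi_2(x_{k+1},y_k)-\frac{\delta_2}{2\bar\alpha_{k,2}}\|y_{k+1}-y_k\|_2^2$. 4. Compute $\alpha_{k+1,2}\in[\alpha_{\min},\alpha_{\max}]$ by the spectral rule with $s_{k,2}=y_{k+1}-y_k$, $g_{k,2}=\nabla_yH(x_{k+1},y_{k+1})-\nabla_yH(x_{k+1},y_k)$. **Spectral rule** ($i\in\{1,2\}$): if $\langle s_{k,i},g_{k,i}\rangle>0$, set $\alpha_{k+1,i}=\max\{\alpha_{\min},\min\{\beta,\alpha_{\max}\}\}$ with $\beta=\frac{\langle s_{k,i},s_{k,i}\rangle}{\langle s_{k,i},g_{k,i}\rangle}$ if $k$ is odd and $\beta=\frac{\langle s_{k,i},g_{k,i}\rangle}{\langle g_{k,i},g_{k,i}\rangle}$ if $k$ is even; otherwise set $\alpha_{k+1,i}=1$. A critical point of $\Psi$ is a point $z$ with $0\in\partial\Psi(z)$, where $\partial$ denotes the limiting (Mordukhovich) subdifferential. *)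

(* Defs.v *)
From HB Require Import structures.
From mathcomp Require Import all_boot all_order all_algebra.
From mathcomp Require Import all_classical all_reals all_analysis.
(* Not imported: the notations of mpoly clash with those of analysis. *)
From mathcomp.multinomials Require mpoly.

Set Implicit Arguments.
Unset Strict Implicit.
Unset Printing Implicit Defensive.

Import Order.TTheory GRing.Theory Num.Theory.
Import numFieldNormedType.Exports.

Local Open Scope classical_set_scope.
Local Open Scope ring_scope.

(* The library norm on 'rV[R]_d is the sup norm.  It is used below only through
   the topology and the bounded sets that it induces; every norm occurring in a
   formula is the Euclidean norm [enorm].
   R^n x R^m is represented by 'rV[R]_(n + m), with (x, y) = row_mx x y. *)

Definition dotp (R : realType) (d : nat) (u v : 'rV[R]_d) : R :=
  \sum_(i < d) u 0 i * v 0 i.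

Definition enorm (R : realType) (d : nat) (u : 'rV[R]_d) : R :=
  Num.sqrt (dotp u u).

Definition grad (R : realType) (d : nat) (F : 'rV[R]_d -> R) (u : 'rV[R]_d) :
    'rV[R]_d :=
  \row_(i < d) 'D_(delta_mx 0 i) F u.

Definition C1 (R : realType) (d : nat) (F : 'rV[R]_d -> R) : Prop :=
  (forall u, differentiable F u) /\ continuous (grad F).

Definition lipschitz_with (R : realType) (d e : nat) (A : set 'rV[R]_d)
    (G : 'rV[R]_d -> 'rV[R]_e) (L : R) : Prop :=
  0 <= L /\
  forall u v, A u -> A v -> enorm (G u - G v) <= L * enorm (u - v).

(* The infimum is attained when G is globally Lipschitz. *)
Definition lipschitz_constant (R : realType) (d e : nat)
    (G : 'rV[R]_d -> 'rV[R]_e) : R :=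
  inf [set L | lipschitz_with setT G L].

Definition proper (R : realType) (d : nat) (f : 'rV[R]_d -> \bar R) : Prop :=
  (forall u, (-oo < f u)%E) /\ (exists u, (f u < +oo)%E).

Definition argmin (R : realType) (d : nat) (F : 'rV[R]_d -> \bar R) :
    set 'rV[R]_d :=
  [set w | forall v, (F w <= F v)%E].

Definition prox (R : realType) (d : nat) (t : R) (sigma : 'rV[R]_d -> \bar R)
    (u : 'rV[R]_d) : set 'rV[R]_d :=
  argmin (fun w => sigma w + (t / 2 * enorm (w - u) ^+ 2)%:E)%E.

(* v is a Frechet subgradient of F at u:
   F u is finite and liminf_(w -> u, w <> u)
     (F w - F u - <v, w - u>) / |w - u| >= 0. *)
Definition frechet_subdiff (R : realType) (d : nat) (F : 'rV[R]_d -> \bar R)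
    (u : 'rV[R]_d) : set 'rV[R]_d :=
  [set v | F u \is a fin_num /\
    (0 <= limf_einf
       (fun w => (F w - F u - (dotp v (w - u))%:E) * ((enorm (w - u))^-1)%:E)
       u^')%E].

Definition limiting_subdiff (R : realType) (d : nat) (F : 'rV[R]_d -> \bar R)
    (u : 'rV[R]_d) : set 'rV[R]_d :=
  [set v | F u \is a fin_num /\
    exists us vs : nat -> 'rV[R]_d,
      [/\ us k @[k --> \oo] --> u,
          F (us k) @[k --> \oo] --> F u,
          forall k, frechet_subdiff F (us k) (vs k) &
          vs k @[k --> \oo] --> v]].

Definition critical_point (R : realType) (d : nat) (F : 'rV[R]_d -> \bar R)
    (u : 'rV[R]_d) : Prop :=
  limiting_subdiff F u 0.

Definition semialgebraic_set (R : realType) (d : nat) (S : set 'rV[R]_d) :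
    Prop :=
  exists (p q : nat) (g h : 'I_p -> 'I_q -> mpoly.mpoly d R),
    S = [set u | exists j, forall i,
           mpoly.meval (u 0) (g j i) = 0 /\ mpoly.meval (u 0) (h j i) < 0].

(* The graph is {(u, t) in R^d x R : F u = t}; points where F u is infinite
   do not contribute. *)
Definition semialgebraic (R : realType) (d : nat) (F : 'rV[R]_d -> \bar R) :
    Prop :=
  semialgebraic_set
    [set w : 'rV[R]_(d + 1) | F (lsubmx w) = (rsubmx w 0 0)%:E].

Definition joint (R : realType) (n m : nat) (H : 'rV[R]_n -> 'rV[R]_m -> R)
    (z : 'rV[R]_(n + m)) : R :=
  H (lsubmx z) (rsubmx z).

Definition Psi (R : realType) (n m : nat) (H : 'rV[R]_n -> 'rV[R]_m -> R)
    (f1 : 'rV[R]_n -> \bar R) (f2 : 'rV[R]_m -> \bar R) (z : 'rV[R]_(n + m)) :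
    \bar R :=
  ((joint H z)%:E + f1 (lsubmx z) + f2 (rsubmx z))%E.

Definition Psi1 (R : realType) (n m : nat) (H : 'rV[R]_n -> 'rV[R]_m -> R)
    (f1 : 'rV[R]_n -> \bar R) (x : 'rV[R]_n) (y : 'rV[R]_m) : \bar R :=
  ((H x y)%:E + f1 x)%E.

Definition Psi2 (R : realType) (n m : nat) (H : 'rV[R]_n -> 'rV[R]_m -> R)
    (f2 : 'rV[R]_m -> \bar R) (x : 'rV[R]_n) (y : 'rV[R]_m) : \bar R :=
  ((H x y)%:E + f2 y)%E.

Definition gradx (R : realType) (n m : nat) (H : 'rV[R]_n -> 'rV[R]_m -> R)
    (x : 'rV[R]_n) (y : 'rV[R]_m) : 'rV[R]_n :=
  grad (fun u => H u y) x.

Definition grady (R : realType) (n m : nat) (H : 'rV[R]_n -> 'rV[R]_m -> R)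
    (x : 'rV[R]_n) (y : 'rV[R]_m) : 'rV[R]_m :=
  grad (fun v => H x v) y.

Definition L1 (R : realType) (n m : nat) (H : 'rV[R]_n -> 'rV[R]_m -> R)
    (y : 'rV[R]_m) : R :=
  lipschitz_constant (fun u => gradx H u y).

Definition L2 (R : realType) (n m : nat) (H : 'rV[R]_n -> 'rV[R]_m -> R)
    (x : 'rV[R]_n) : R :=
  lipschitz_constant (fun v => grady H x v).

Record assumptionA (R : realType) (n m : nat) (H : 'rV[R]_n -> 'rV[R]_m -> R)
    (f1 : 'rV[R]_n -> \bar R) (f2 : 'rV[R]_m -> \bar R)
    (x : nat -> 'rV[R]_n) (y : nat -> 'rV[R]_m) : Prop := AssumptionA {
  A1_f1 : [/\ proper f1, lower_semicontinuous f1 &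
              (-oo < ereal_inf (range f1))%E];
  A1_f2 : [/\ proper f2, lower_semicontinuous f2 &
              (-oo < ereal_inf (range f2))%E];
  A2 : C1 (joint H) /\ (-oo < ereal_inf (range (Psi H f1 f2)))%E;
  A3 : forall B : set 'rV[R]_(n + m), bounded_set B ->
         exists L, lipschitz_with B (grad (joint H)) L;
  A4_x : forall y0, exists L, lipschitz_with setT (fun u => gradx H u y0) L;
  A4_y : forall x0, exists L, lipschitz_with setT (fun v => grady H x0 v) L;
  A5 : exists lambda1 lambda2 : R,
         [/\ 0 < lambda1, 0 < lambda2,
             (ereal_sup (range (fun k => (L1 H (y k))%:E)) <= lambda1%:E)%E &
             (ereal_sup (range (fun k => (L2 H (x k))%:E)) <= lambda2%:E)%E]
}.

(* One backtracking proximal gradient step from u to u', for the nonsmooth term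
   f, the gradient g at u and the objective P, with initial step size alpha.
   For each exponent j a trial point in the (possibly multi-valued) prox is
   selected; i is the first exponent at which the selected point is accepted,
   and u' is that point. *)
Definition backtracking_step (R : realType) (d : nat)
    (f P : 'rV[R]_d -> \bar R) (g : 'rV[R]_d) (rho delta alpha : R)
    (u u' : 'rV[R]_d) : Prop :=
  let step (j : nat) : R := rho ^+ j * alpha in
  let trial (j : nat) : set 'rV[R]_d :=
    prox (1 / step j) f (u - step j *: g) in
  let accepted (j : nat) (w : 'rV[R]_d) : bool :=
    (P w <= P u - (delta / (2 * step j) * enorm (w - u) ^+ 2)%:E)%E in
  exists i : nat,
    [/\ trial i u', accepted i u' &
        forall j : nat, (j < i)%N -> exists2 w, trial j w & ~~ accepted j w].

Definition spectral_rule (R : realType) (d : nat) (amin amax : R) (k : nat)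
    (s g : 'rV[R]_d) : R :=
  if 0 < dotp s g then
    let beta := if odd k then dotp s s / dotp s g else dotp s g / dotp g g in
    Num.max amin (Num.min beta amax)
  else 1.

Record sPALM (R : realType) (n m : nat) (H : 'rV[R]_n -> 'rV[R]_m -> R)
    (f1 : 'rV[R]_n -> \bar R) (f2 : 'rV[R]_m -> \bar R)
    (rho1 delta1 rho2 delta2 amin amax : R)
    (x : nat -> 'rV[R]_n) (y : nat -> 'rV[R]_m) (alpha1 alpha2 : nat -> R) :
    Prop := SPALM {
  sPALM_alpha1_range : forall k, amin <= alpha1 k <= amax;
  sPALM_alpha2_range : forall k, amin <= alpha2 k <= amax;
  sPALM_x : forall k,
    backtracking_step f1 (fun w => Psi1 H f1 w (y k)) (gradx H (x k) (y k))
      rho1 delta1 (alpha1 k) (x k) (x k.+1);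
  sPALM_alpha1 : forall k,
    alpha1 k.+1 = spectral_rule amin amax k (x k.+1 - x k)
      (gradx H (x k.+1) (y k) - gradx H (x k) (y k));
  sPALM_y : forall k,
    backtracking_step f2 (fun w => Psi2 H f2 (x k.+1) w)
      (grady H (x k.+1) (y k)) rho2 delta2 (alpha2 k) (y k) (y k.+1);
  sPALM_alpha2 : forall k,
    alpha2 k.+1 = spectral_rule amin amax k (y k.+1 - y k)
      (grady H (x k.+1) (y k.+1) - grady H (x k.+1) (y k))
}.

(* Main.v *)
(* Every iterate comes with a subgradient v that is proximal with a constant C
   uniform on a box containing the sequence: F w >= F z + <v, w - z> - C |w - z|^2
   for all w in the box. The pairs (z, v) of this kind on a level F z = r form a
   closed semialgebraic set, so one can select, semialgebraically in r, a point
   z(r) of least slope on the level r. Coordinates of z(r) and the least slope are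
   monotone for r slightly above the limit value of F, by quantifier elimination
   and the resulting tameness of one-variable functions. Comparing z(r) with z(r')
   through the proximal inequality gives r - r' <= |v| |z(r) - z(r')| up to a
   quadratic error, and summing over a subdivision yields the Kurdyka-Lojasiewicz
   inequality s - t <= |v| (phi s - phi t), where phi is the l^1 length of the
   curve z, bounded because z is bounded and monotone. With the sufficient decrease of F
   and |v_(k+1)| <= b |z_(k+1) - z_k| this bounds the length of the sequence, and
   the proximal inequality passes to the limit with v = 0. *)

Require Import Defs.
From HB Require Import structures.
From mathcomp Require Import all_boot all_order all_algebra.
From mathcomp Require Import all_classical all_reals all_analysis.
From mathcomp Require Import ring lra.
From mathcomp.real_closed Require polyrcf ordered_qelim qe_rcf.
From mathcomp.multinomials Require mpoly.

Set Implicit Arguments.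
Unset Strict Implicit.
Unset Printing Implicit Defensive.

Import Order.TTheory GRing.Theory Num.Theory.
Import numFieldNormedType.Exports.

Local Open Scope classical_set_scope.
Local Open Scope ring_scope.

(** * Semialgebraic predicates and tameness on the line *)

(** A Kurdyka-Lojasiewicz inequality is usually drawn from a stratification of the graph and from
    derivatives along definable arcs. Fixing one curvature constant C avoids both. Prox steps give
    quadratic lower bounds on [f1] and [f2] whose curvature is governed by the inverse step size,
    and backtracking keeps the step sizes away from 0; [H] adds the Lipschitz constant of its
    gradient on the box. With C fixed, being a subgradient is a condition quantified over points of
    the box, without limits, so it is definable and survives passage to the limit. The curve z(r)
    then needs neither continuity nor a derivative. Its length is measured in l^1 because, for a
    coordinatewise monotone curve, this distance is exactly the increment of a single function phi.
    The box leaves a margin of 1 around the sequence: the limit is then interior, and an inequality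
    on the box is enough for a Frechet subgradient. *)

Module QE := mathcomp.real_closed.ordered_qelim.ord.

Section Semialgebraic.
Variable R : realType.

(* Predicates are over environments e : nat -> R of real variables, of which only
   finitely many matter; a quantifier over a vector of dimension d prepends d
   variables, as in [sa_exv]. *)
Inductive pol : ((nat -> R) -> R) -> Prop :=
| pol_var i : pol (fun e => e i)
| pol_const c : pol (fun=> c)
| pol_add f g : pol f -> pol g -> pol (fun e => f e + g e)
| pol_mul f g : pol f -> pol g -> pol (fun e => f e * g e).

(** Quantifier-free on purpose: tameness is proved by induction on this type, and closure under
    quantifiers is recovered by elimination in [sa_ex]. *)
Inductive sa : ((nat -> R) -> Prop) -> Prop :=
| sa_pos f : pol f -> sa (fun e => 0 < f e)
| sa_not P : sa P -> sa (fun e => ~ P e)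
| sa_and P Q : sa P -> sa Q -> sa (fun e => P e /\ Q e).

Lemma sa_ext P Q : (forall e, P e <-> Q e) -> sa P -> sa Q.
Proof. by move=> PQ; have -> : P = Q by apply/funext => e; apply/propext. Qed.

Lemma pol_ext f g : f =1 g -> pol f -> pol g.
Proof. by move=> /funext ->. Qed.

Lemma pol_opp f : pol f -> pol (fun e => - f e).
Proof.
move=> pf; apply: (@pol_ext (fun e => -1 * f e)) => [e|]; first by rewrite mulN1r.
exact: pol_mul (pol_const _) pf.
Qed.

Lemma pol_sub f g : pol f -> pol g -> pol (fun e => f e - g e).
Proof. by move=> pf /pol_opp; exact: pol_add. Qed.

Lemma pol_exp f k : pol f -> pol (fun e => f e ^+ k).
Proof.
move=> pf; elim: k => [|k IH]; first exact: (pol_const 1).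
by apply: pol_ext (pol_mul pf IH) => e; rewrite exprS.
Qed.

Lemma pol_sum (I : Type) (s : seq I) (Q : pred I) f :
  (forall i, pol (f i)) -> pol (fun e => \sum_(i <- s | Q i) f i e).
Proof.
move=> pf; elim: s => [|i s IH].
  by apply: pol_ext (pol_const 0) => e; rewrite big_nil.
case Qi : (Q i); last by apply: pol_ext IH => e; rewrite big_cons Qi.
by apply: pol_ext (pol_add (pf i) IH) => e; rewrite big_cons Qi.
Qed.

Lemma pol_prod (I : Type) (s : seq I) (Q : pred I) f :
  (forall i, pol (f i)) -> pol (fun e => \prod_(i <- s | Q i) f i e).
Proof.
move=> pf; elim: s => [|i s IH].
  by apply: pol_ext (pol_const 1) => e; rewrite big_nil.
case Qi : (Q i); last by apply: pol_ext IH => e; rewrite big_cons Qi.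
by apply: pol_ext (pol_mul (pf i) IH) => e; rewrite big_cons Qi.
Qed.

Lemma pol_comp (s : (nat -> R) -> nat -> R) f :
  (forall i, pol (fun e => s e i)) -> pol f -> pol (fun e => f (s e)).
Proof.
move=> ps; elim=> [i|c|g h _ pg _ ph|g h _ pg _ ph]; [exact: ps | exact: pol_const | |].
- exact: pol_add.
- exact: pol_mul.
Qed.

Lemma sa_comp (s : (nat -> R) -> nat -> R) P :
  (forall i, pol (fun e => s e i)) -> sa P -> sa (fun e => P (s e)).
Proof.
move=> ps; elim=> [f pf|Q _ IH|P' Q _ IHP _ IHQ].
- exact/sa_pos/pol_comp.
- exact: sa_not.
- exact: sa_and.
Qed.

Lemma sa_or P Q : sa P -> sa Q -> sa (fun e => P e \/ Q e).
Proof.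
move=> /sa_not sP /sa_not sQ; apply: sa_ext (sa_not (sa_and sP sQ)) => e.
by rewrite -not_orP; split=> [/contrapT|h] //; apply/notP.
Qed.

Lemma sa_imp P Q : sa P -> sa Q -> sa (fun e => P e -> Q e).
Proof. by move=> /sa_not sP sQ; apply: sa_ext (sa_or sP sQ) => e; rewrite implyE. Qed.

Lemma sa_lt f g : pol f -> pol g -> sa (fun e => f e < g e).
Proof.
move=> pf pg; apply: sa_ext (sa_pos (pol_sub pg pf)) => e.
by rewrite subr_gt0.
Qed.

Lemma sa_le f g : pol f -> pol g -> sa (fun e => f e <= g e).
Proof.
move=> pf pg; apply: sa_ext (sa_not (sa_lt pg pf)) => e.
by rewrite leNgt; split=> /negP.
Qed.

Lemma sa_eq f g : pol f -> pol g -> sa (fun e => f e = g e).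
Proof.
move=> pf pg; apply: sa_ext (sa_and (sa_le pf pg) (sa_le pg pf)) => e.
split=> [[fg gf]|->]; last by split.
by apply/eqP; rewrite eq_le fg gf.
Qed.

Lemma sa_const (A : Prop) : sa (fun=> A).
Proof.
have [a|na] := pselect A.
  by apply: (sa_ext _ (sa_pos (pol_const 1))) => e; split=> // _; exact: ltr01.
by apply: (sa_ext _ (sa_pos (pol_const 0))) => e; rewrite ltxx.
Qed.

Lemma sa_all_in (I : eqType) (s : seq I) (P : I -> (nat -> R) -> Prop) :
  (forall i, sa (P i)) -> sa (fun e => forall i, i \in s -> P i e).
Proof.
move=> sP; elim: s => [|i s IH]; first by apply: sa_ext (sa_const True) => e.
apply: sa_ext (sa_and (sP i) IH) => e; split=> [[Pi Ps] j|Ps].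
  by rewrite inE => /orP[/eqP ->|/Ps].
by split=> [|j js]; apply: Ps; rewrite inE ?eqxx ?js ?orbT.
Qed.

Lemma sa_all_fin (I : finType) (P : I -> (nat -> R) -> Prop) :
  (forall i, sa (P i)) -> sa (fun e => forall i, P i e).
Proof.
move=> sP; apply: sa_ext (sa_all_in (enum I) sP) => e.
by split=> Ps i; [apply: Ps; rewrite mem_enum | move=> _; exact: Ps].
Qed.

Lemma sa_ex_fin (I : finType) (P : I -> (nat -> R) -> Prop) :
  (forall i, sa (P i)) -> sa (fun e => exists i, P i e).
Proof.
move=> sP; apply: sa_ext (sa_not (sa_all_fin (fun i => sa_not (sP i)))) => e.
by rewrite -existsNP; split=> [[i /contrapT]|[i Pi]]; exists i => //; apply/notP.
Qed.

Definition econs (x : R) (e : nat -> R) (i : nat) : R :=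
  if i is i'.+1 then e i' else x.

(** Formulas are evaluated on finite sequences, predicates on infinite environments; the bound [k]
    makes the transfer independent of what lies beyond. *)
Definition agree (k : nat) (s : seq R) (e : nat -> R) : Prop :=
  forall i, (i < k)%N -> s`_i = e i.

Lemma pol_term f : pol f -> exists k (t : GRing.term R), GRing.rterm t /\
  forall s e, agree k s e -> GRing.eval s t = f e.
Proof.
elim=> [i|c|g h _ [k [t [rt tg]]] _ [l [u [ru uh]]]|g h _ [k [t [rt tg]]] _ [l [u [ru uh]]]].
- by exists i.+1, (GRing.Var _ i); split=> // s e; exact.
- by exists 0%N, (GRing.Const c).
- exists (maxn k l), (GRing.Add t u); split=> [|s e se]; first by rewrite /= rt.
  by congr (_ + _); [apply: tg|apply: uh] => i ik; apply: se; rewrite leq_max ik ?orbT.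
- exists (maxn k l), (GRing.Mul t u); split=> [|s e se]; first by rewrite /= rt.
  by congr (_ * _); [apply: tg|apply: uh] => i ik; apply: se; rewrite leq_max ik ?orbT.
Qed.

Lemma sa_formula P : sa P -> exists k (f : QE.formula R),
  QE.rformula f /\ forall s e, agree k s e -> (QE.holds s f <-> P e).
Proof.
elim=> [f /pol_term [k [t [rt tf]]]|Q _ [k [f [rf fQ]]]|
  P' Q _ [k [f [rf fP]]] _ [l [g [rg gQ]]]].
- exists k, (QE.Lt (GRing.NatConst _ 0) t); split=> // s e /tf /= ->.
  by rewrite mulr0n.
- by exists k, (QE.Not f); split=> // s e /fQ /= ->.
- exists (maxn k l), (QE.And f g); split=> [|s e se]; first by rewrite /= rf.
  by rewrite /= (fP s e) ?(gQ s e) // => i ik; apply: se; rewrite leq_max ik ?orbT.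
Qed.

Lemma pol_eval (s : (nat -> R) -> seq R) (t : GRing.term R) :
  (forall i, pol (fun e => (s e)`_i)) -> GRing.rterm t ->
  pol (fun e => GRing.eval (s e) t).
Proof.
move=> ps; elim: t => //=.
- by move=> c _; exact: pol_const.
- by move=> k _; exact: pol_const.
- by move=> t IHt u IHu /andP[/IHt pt /IHu pu]; exact: pol_add.
- by move=> t IHt /IHt; exact: pol_opp.
- move=> t IHt k /IHt pt; apply: pol_ext (pol_mul pt (pol_const k%:R)) => e.
  by rewrite mulr_natr.
- by move=> t IHt u IHu /andP[/IHt pt /IHu pu]; exact: pol_mul.
- by move=> t IHt k /IHt; exact: pol_exp.
Qed.

Lemma sa_qf_holds (s : (nat -> R) -> seq R) (f : QE.formula R) :
  (forall i, pol (fun e => (s e)`_i)) -> QE.qf_form f -> QE.rformula f ->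
  sa (fun e => QE.holds (s e) f).
Proof.
move=> ps; elim: f => //=.
- by move=> b _ _; exact: sa_const.
- by move=> t u _ /andP[rt ru]; apply: sa_eq; exact: pol_eval.
- by move=> t u _ /andP[rt ru]; apply: sa_lt; exact: pol_eval.
- by move=> t u _ /andP[rt ru]; apply: sa_le; exact: pol_eval.
- by move=> f IHf g IHg /andP[qf qg] /andP[rf rg]; apply: sa_and; [exact: IHf|exact: IHg].
- by move=> f IHf g IHg /andP[qf qg] /andP[rf rg]; apply: sa_or; [exact: IHf|exact: IHg].
- by move=> f IHf g IHg /andP[qf qg] /andP[rf rg]; apply: sa_imp; [exact: IHf|exact: IHg].
- by move=> f IHf qf rf; apply: sa_not; exact: IHf.
Qed.

(** Tarski-Seidenberg: the predicate becomes a formula with real constants, its quantifier is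
    eliminated over the real closed field R, and the quantifier-free result is read back as an [sa]
    predicate. *)
Lemma sa_ex (Q : R -> (nat -> R) -> Prop) :
  sa (fun e => Q (e 0%N) (fun i => e i.+1)) -> sa (fun e => exists x, Q x e).
Proof.
move=> /sa_formula [k [f [rf fQ]]].
pose g : QE.formula R := QE.Exists 0 f.
pose h := @QE.quantifier_elim R
    (fun i c => qe_rcf.qfr_to_formula (qe_rcf.wproj i c)) g.
have rg : QE.rformula g by [].
have /andP[qh rh] : QE.qf_form h && QE.rformula h.
  exact: (QE.quantifier_elim_wf (@qe_rcf.wf_QE_wproj R)).
(* Slot 0 is a dummy, overwritten by the quantified value; the free variables are shifted by one
   behind it. *)
pose s (e : nat -> R) := 0 :: mkseq e k.
have ps i : pol (fun e => (s e)`_i).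
  case: i => [|i]; first exact: pol_const.
  have [ik|ki] := ltnP i k.
    by apply: pol_ext (pol_var i) => e /=; rewrite nth_mkseq.
  by apply: pol_ext (pol_const 0) => e /=; rewrite nth_default ?size_mkseq.
apply: sa_ext (sa_qf_holds ps qh rh) => e.
have -> : QE.holds (s e) h <-> QE.holds (s e) g.
  have elimP := QE.quantifier_elim_rformP (@qe_rcf.wf_QE_wproj R)
    (@qe_rcf.valid_QE_wproj R) (s e) rg.
  split=> [/(QE.qf_evalP _ qh)|]; first by move/elimP.
  move/elimP.
  by move/(QE.qf_evalP _ qh).
have ag x : agree k (set_nth 0 (s e) 0 x) (econs x e).
  by move=> [|i] ik //=; rewrite nth_mkseq // ltnW.
by split=> -[x Qx]; exists x; [exact: (fQ _ _ (ag x)).1 | exact: (fQ _ _ (ag x)).2].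
Qed.

Lemma sa_forall (Q : R -> (nat -> R) -> Prop) :
  sa (fun e => Q (e 0%N) (fun i => e i.+1)) -> sa (fun e => forall x, Q x e).
Proof.
move=> /sa_not sQ; apply: sa_ext (sa_not (@sa_ex (fun x e => ~ Q x e) sQ)) => e.
by rewrite -forallNP; split=> h x; [apply: contrapT; exact: h | apply; exact: h].
Qed.

Definition polv d (V : (nat -> R) -> 'rV[R]_d) :=
  forall i, pol (fun e => V e 0 i).

Lemma sa_exv d (Q : 'rV[R]_d -> (nat -> R) -> Prop) :
  sa (fun e => Q (\row_i e i) (fun i => e (d + i)%N)) ->
  sa (fun e => exists w, Q w e).
Proof.
elim: d Q => [|d IH] Q sQ.
  apply: sa_ext sQ => e; split=> [Qe|[w]]; first by exists (\row_i e i).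
  by rewrite [w]thinmx0 [X in _ -> Q X _]thinmx0.
(* The scalar is quantified outside the vector [w], so its variable comes right after the [d]
   variables of [w]: it must be the last coordinate. *)
pose ext (x : R) (w : 'rV[R]_d) : 'rV[R]_d.+1 :=
  \row_i (if insub (val i) is Some j then w 0 j else x).
apply: (@sa_ext (fun e => exists x w, Q (ext x w) e)) => [e|].
  split=> [[x [w Qw]]|[w Qw]]; first by exists (ext x w).
  exists (w 0 ord_max), (\row_j w 0 (widen_ord (leqnSn d) j)).
  suff -> : ext (w 0 ord_max) (\row_j w 0 (widen_ord (leqnSn d) j)) = w by [].
  apply/rowP => i; rewrite mxE; case: insubP => [j _ ji|].
    by rewrite mxE; congr (w 0 _); apply: val_inj.
  rewrite -leqNgt => di; congr (w 0 _); apply: val_inj => /=.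
  by apply/eqP; rewrite eqn_leq di -ltnS ltn_ord.
apply: sa_ex; apply: IH => /=.
apply: sa_ext sQ => e.
suff -> : \row_(i < d.+1) e i = ext (e (d + 0)%N) (\row_i e i).
  by under [fun i => e (d + i.+1)%N]eq_fun do rewrite addnS.
apply/rowP => i; rewrite !mxE; case: insubP => [j _ <-|]; first by rewrite mxE.
rewrite -leqNgt addn0 => di; congr e.
by apply/eqP; rewrite eqn_leq di -ltnS ltn_ord.
Qed.

Lemma sa_forallv d (Q : 'rV[R]_d -> (nat -> R) -> Prop) :
  sa (fun e => Q (\row_i e i) (fun i => e (d + i)%N)) ->
  sa (fun e => forall w, Q w e).
Proof.
move=> /sa_not sQ; apply: sa_ext (sa_not (@sa_exv d (fun x e => ~ Q x e) sQ)) => e.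
by rewrite -forallNP; split=> h x; [apply: contrapT; exact: h | apply; exact: h].
Qed.

End Semialgebraic.

Section SemialgebraicTools.
Variable R : realType.
Implicit Types (P : (nat -> R) -> Prop) (f : (nat -> R) -> R).

Lemma pol_ren (c : nat -> nat) (f : (nat -> R) -> R) :
  pol f -> pol (fun e => f (fun i => e (c i))).
Proof. by apply: pol_comp => i; exact: pol_var. Qed.

Lemma polv_sub d (V W : (nat -> R) -> 'rV[R]_d) :
  polv V -> polv W -> polv (fun e => V e - W e).
Proof. by move=> pV pW i; apply: pol_ext (pol_sub (pV i) (pW i)) => e; rewrite !mxE. Qed.

Lemma pol_dotp d (V W : (nat -> R) -> 'rV[R]_d) :
  polv V -> polv W -> pol (fun e => dotp (V e) (W e)).
Proof. by move=> pV pW; apply: pol_sum => i; exact: pol_mul. Qed.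

Lemma pol_meval d (V : (nat -> R) -> 'rV[R]_d) (p : mpoly.mpoly d R) :
  polv V -> pol (fun e => mpoly.meval (V e 0) p).
Proof.
move=> pV; under eq_fun do rewrite mpoly.mevalE.
apply: pol_sum => m; apply: pol_mul; first exact: pol_const.
by apply: pol_prod => i; exact: pol_exp.
Qed.

Lemma sa_semialgebraic d (F : 'rV[R]_d -> \bar R) (V : (nat -> R) -> 'rV[R]_d) f :
  semialgebraic F -> polv V -> pol f -> sa (fun e => F (V e) = (f e)%:E).
Proof.
move=> [p [q [g [h gh]]]] pV pf.
pose W e : 'rV[R]_(d + 1) := row_mx (V e) (\row_(_ < 1) f e).
have pW : polv W.
  move=> i; rewrite -[i]splitK; case: (fintype.split i) => j /=.
    by apply: pol_ext (pV j) => e; rewrite /W row_mxEl.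
  by apply: pol_ext pf => e; rewrite /W row_mxEr mxE.
apply: (@sa_ext _ (fun e => exists j, forall i,
    mpoly.meval (W e 0) (g j i) = 0 /\ mpoly.meval (W e 0) (h j i) < 0)).
  move=> e; have := congr1 (fun A : set _ => A (W e)) gh.
  by rewrite /= /W row_mxKl row_mxKr mxE => <-.
apply: sa_ex_fin => j; apply: sa_all_fin => i; apply: sa_and.
  by apply: sa_eq (pol_const _); exact: pol_meval.
by apply: sa_lt (pol_const _); exact: pol_meval.
Qed.

Lemma pol_line f (c : nat -> R) : pol f ->
  exists p : {poly R}, forall x, f (econs x c) = p.[x].
Proof.
elim=> [[|i]|a|g h _ [p gp] _ [q hq]|g h _ [p gp] _ [q hq]].
- by exists 'X => x; rewrite hornerX.
- by exists (c i)%:P => x; rewrite hornerC.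
- by exists a%:P => x; rewrite hornerC.
- by exists (p + q) => x; rewrite hornerD gp hq.
- by exists (p * q) => x; rewrite hornerM gp hq.
Qed.

(** A nonzero polynomial in one variable keeps its sign between [a] and its next root, and boolean
    combinations only intersect finitely many such intervals. *)
Lemma sa_tame_right P (c : nat -> R) (a : R) : sa P ->
  exists2 b, a < b &
    (forall x, a < x < b -> P (econs x c)) \/
    (forall x, a < x < b -> ~ P (econs x c)).
Proof.
elim=> [f /pol_line-/(_ c) [p fp]|Q _ [b ab [h|h]]|P' Q _ [b ab hP] _ [b' ab' hQ]].
- have [p0|p0] := eqVneq p 0.
    exists (a + 1); first by rewrite ltrDl.
    by right=> x _; rewrite fp p0 horner0 ltxx.
  (* The cap [a + 1] is arbitrary; it is the value of [next_root] when [p] has no root in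
     between. *)
  exists (polyrcf.next_root p a (a + 1)); first by rewrite polyrcf.next_root_gt // ltrDl.
  have sg x : a < x < polyrcf.next_root p a (a + 1) ->
      Num.sg p.[x] = polyrcf.sgp_right p a.
    move=> ax; apply: (@polyrcf.sgr_neighpr _ (a + 1)).
    by rewrite /polyrcf.neighpr in_itv.
  have [s0|s0] := boolP (0 < polyrcf.sgp_right p a); [left|right] => x /sg sx.
    by rewrite fp -sgr_gt0 sx.
  by rewrite fp -sgr_gt0 sx; exact/negP.
- by exists b => //; right=> x /h Qx; apply.
- by exists b => //; left.
- exists (Num.min b b'); first by rewrite lt_min ab.
  have m x : a < x < Num.min b b' -> a < x < b /\ a < x < b'.
    by rewrite lt_min => /andP[-> /andP[-> ->]].
  case: hP => hP; last by right=> x /m [/hP nP _] [].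
  case: hQ => hQ; last by right=> x /m [_ /hQ nQ] [].
  by left=> x /m [/hP ? /hQ ?].
Qed.

Lemma sa_tame_left P (c : nat -> R) (a : R) : sa P ->
  exists2 b, b < a &
    (forall x, b < x < a -> P (econs x c)) \/
    (forall x, b < x < a -> ~ P (econs x c)).
Proof.
move=> sP.
pose s (e : nat -> R) i := if i is i'.+1 then e i else - e 0%N.
have ps i : pol (fun e => s e i).
  by case: i => [|i]; [exact: pol_opp (pol_var _ _) | exact: pol_var].
have [b ab h] := sa_tame_right c (- a) (sa_comp ps sP).
have sE x : s (econs (- x) c) = econs x c.
  by apply/funext => -[|i] //=; rewrite opprK.
have ineq x : - b < x < a -> - a < - x < b by rewrite ltrN2 ltrNl andbC.
exists (- b); first by rewrite ltrNl.
by case: h => h; [left|right] => x /ineq /h; rewrite sE.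
Qed.

End SemialgebraicTools.

(** * Monotonicity of semialgebraic functions of one variable *)

Section Monotonicity.
Variable R : realType.
Implicit Types (g : R -> R).

(** By tameness, a definable [g] satisfies [lt_right] wherever [ge_right] fails, and [gt_left]
    wherever [le_left] fails. *)
Definition ge_right g x := exists2 y, x < y & forall s, x < s < y -> g x <= g s.
Definition le_left g x := exists2 y, y < x & forall s, y < s < x -> g s <= g x.
Definition lt_right g x := exists2 y, x < y & forall s, x < s < y -> g s < g x.
Definition gt_left g x := exists2 y, y < x & forall s, y < s < x -> g x < g s.

(** No continuity is available. Let t be the supremum of the points up to which [g] stays above
    [g r]: the left condition carries the inequality to t itself, and the right condition pushes it
    beyond t unless t = s. *)
Lemma local_nondecreasing g a b :
  (forall x, a < x < b -> ge_right g x /\ le_left g x) ->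
  forall r s, a < r -> r <= s -> s < b -> g r <= g s.
Proof.
move=> loc r s ar; rewrite le_eqVlt => /predU1P[->//|rs] sb.
pose S := [set t | r <= t <= s /\ forall u, r <= u <= t -> g r <= g u].
have Sr : S r.
  split=> [|u]; first by rewrite lexx ltW.
  by move=> ru; have -> : u = r by apply/eqP; rewrite eq_le andbC.
have hS : has_sup S.
  by split; [exists r | exists s => t [/andP[]]].
set t := sup S.
have rt : r <= t by apply: ub_le_sup => //; exact: hS.2.
have ts : t <= s by apply: ge_sup => [|u [/andP[]]//]; exists r.
have [|grt [y yt gl]] := loc t.
  by rewrite (lt_le_trans ar rt) (le_lt_trans ts sb).
have below u : r <= u < t -> g r <= g u.
  move=> /andP[ru ut].
  have tu : 0 < t - u by rewrite subr_gt0.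
  have [w [_ Sw] uw] := sup_adherent tu hS.
  by apply: Sw; rewrite ru ltW //; move: uw; rewrite opprB addrC subrK.
have grt' : g r <= g t.
  have [<-//|rnt] := eqVneq r t; have {}rt : r < t by rewrite lt_neqAle rnt.
  have m : Num.max r y < t by rewrite gt_max rt yt.
  have [m1 m2] := midf_lt m.
  move: m1; rewrite gt_max => /andP[rm ym].
  apply: (@le_trans _ _ (g ((Num.max r y + t) / 2))).
    by apply: below; rewrite m2 ltW.
  by apply: gl; rewrite m2 ym.
have [ts0|nts] := eqVneq t s; first by rewrite -ts0.
have {}ts : t < s by rewrite lt_neqAle nts.
have [z tz gz] := grt.
have m : t < Num.min s z by rewrite lt_min ts tz.
have [m1 m2] := midf_lt m.
move: m2; rewrite lt_min => /andP[ms mz].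
set w := (t + Num.min s z) / 2 in m1 ms mz.
suff Sw : S w by move: (ub_le_sup hS.2 Sw); rewrite -/t leNgt m1.
split=> [|u /andP[ru uw]]; first by rewrite (le_trans rt (ltW m1)) ltW.
have [ut|tu|->//] := ltgtP u t; first by apply: below; rewrite ru.
by apply: le_trans grt' (gz _ _); rewrite tu (le_lt_trans uw).
Qed.

(* Pick a rational interval around x witnessing the two conditions: since the
   left one is strict, distinct points get distinct intervals. *)
Lemma not_everywhere_local_min g a b : a < b ->
  ~ (forall x, a < x < b -> ge_right g x /\ gt_left g x).
Proof.
move=> ab loc.
have wit x : exists pq : rat * rat, a < x < b ->
    [/\ ratr pq.1 < x < ratr pq.2,
        forall s, x < s < ratr pq.2 -> g x <= g s &
        forall s, ratr pq.1 < s < x -> g x < g s].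
  have [axb|] := pselect (a < x < b); last by move=> ?; exists (0, 0).
  have [[y xy gy] [z zx gz]] := loc x axb.
  have [q qy] := rat_in_itvoo xy; have [p pz] := rat_in_itvoo zx.
  move: qy pz; rewrite !in_itv /= => /andP[xq qy] /andP[zp px].
  exists (p, q) => _ /=; split=> [|s /andP[xs sq]|s /andP[ps sx]].
  - by rewrite px xq.
  - by apply: gy; rewrite xs (lt_trans sq).
  - by apply: gz; rewrite sx (lt_trans zp).
have {wit} [f fP] := choice wit.
have cnt : countable (`]a, b[ : set R)%classic.
  apply/countable_injP; exists (pickle \o f) => x y.
  rewrite !inE /= !in_itv /= => axb ayb /(pcan_inj pickleK) fxy.
  wlog xy : x y axb ayb fxy / x < y.
    move=> W; have [xy|yx|//] := ltgtP x y; first exact: W.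
    by apply/esym; apply: W.
  have [/andP[px xq] gx _] := fP x axb; have [/andP[py yq] _ gy] := fP y ayb.
  have : g y < g x by apply: gy; rewrite xy -fxy px.
  by rewrite ltNge gx // xy fxy.
have := countable_lebesgue_measure0 cnt.
rewrite lebesgue_measure_itv /= lte_fin ab -EFinB => -[] /eqP.
by rewrite subr_eq0 gt_eqF.
Qed.

Lemma local_nonincreasing g a b :
  (forall x, a < x < b -> lt_right g x /\ gt_left g x) ->
  forall r s, a < r -> r <= s -> s < b -> g s <= g r.
Proof.
move=> loc r s ar rs sb; rewrite -lerN2.
apply: (@local_nondecreasing (fun t => - g t) a b) => // x /loc [[y xy gy] [z zx gz]].
split; first by exists y => // t /gy; rewrite lerN2 => /ltW.
by exists z => // t /gz; rewrite lerN2 => /ltW.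
Qed.

Lemma not_everywhere_local_max g a b : a < b ->
  ~ (forall x, a < x < b -> lt_right g x /\ le_left g x).
Proof.
move=> ab loc; apply: (@not_everywhere_local_min (fun t => - g (- t)) (- b) (- a)).
  by rewrite ltrN2.
move=> x xI; have [] := loc (- x); first by rewrite ltrNl ltrNr andbC.
move=> [y xy gy] [z zx gz]; split.
  exists (- z) => [|s sI]; first by rewrite ltrNr.
  by rewrite lerN2 gz // ltrNr ltrN2 andbC.
exists (- y) => [|s sI]; first by rewrite ltrNl.
by rewrite ltrN2 gy // ltrN2 ltrNl andbC.
Qed.

Section Definable.
Variable g : R -> R.
Hypothesis sg : sa (fun e => g (e 0%N) = e 1%N).

Lemma sa_graph p q : pol p -> pol q -> sa (fun e => g (p e) = q e).
Proof.
move=> pp pq.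
apply: (@sa_comp _ (fun e i => if i is 0%N then p e else q e) _ _ sg).
by case.
Qed.

(** Values of [g] are not polynomial terms, so they are named by bound variables and tied to [g]
    through its graph. *)
Lemma sa_fun_le p q : pol p -> pol q -> sa (fun e => g (p e) <= g (q e)).
Proof.
move=> pp pq.
apply: (@sa_ext _ (fun e => exists t, exists s,
    [/\ g (p e) = t, g (q e) = s & t <= s])).
  by move=> e; split=> [[t [s [<- <-]]]//|]; exists (g (p e)), (g (q e)).
apply: sa_ex; apply: sa_ex.
apply: (@sa_ext _ (fun e => (g (p (fun i => e i.+2)) = e 1%N /\
  g (q (fun i => e i.+2)) = e 0%N) /\ e 1%N <= e 0%N)).
  by move=> e; split=> [[[]]|[]].
apply: sa_and; last by apply: sa_le; exact: pol_var.
apply: sa_and; apply: sa_graph; try exact: pol_var.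
  exact: (pol_ren (fun i => i.+2) pp).
exact: (pol_ren (fun i => i.+2) pq).
Qed.

(* By tameness ge_right and le_left are each everywhere true or everywhere false
   near a; the two combinations without monotonicity make every point a local
   extremum that is strict on one side, which countability excludes. *)
Lemma sa_monotone_right a : exists2 b, a < b &
  (forall r s, a < r -> r <= s -> s < b -> g r <= g s) \/
  (forall r s, a < r -> r <= s -> s < b -> g s <= g r).
Proof.
have pv i : pol (fun e : nat -> R => e i) by exact: pol_var.
have dR x : ge_right g x \/ lt_right g x.
  have [y xy [h|h]] := sa_tame_right (fun=> x) x (sa_fun_le (pv 1%N) (pv 0%N)).
    by left; exists y.
  by right; exists y => // s /h /negP; rewrite -ltNge.
have dL x : le_left g x \/ gt_left g x.
  have [y xy [h|h]] := sa_tame_left (fun=> x) x (sa_fun_le (pv 0%N) (pv 1%N)).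
    by left; exists y.
  by right; exists y => // s /h /negP; rewrite -ltNge.
have sR : sa (fun e => ge_right g (e 0%N)).
  apply: (@sa_ext _ (fun e => exists y, e 0%N < y /\
      forall s, (e 0%N < s /\ s < y) -> g (e 0%N) <= g s)).
    move=> e; split=> -[y]; first by case=> xy h; exists y => // s /andP; exact: h.
    by move=> xy h; exists y; split=> // s /andP; exact: h.
  apply: sa_ex; apply: sa_and; first exact: sa_lt.
  apply: sa_forall; apply: sa_imp; last exact: sa_fun_le.
  by apply: sa_and; exact: sa_lt.
have sL : sa (fun e => le_left g (e 0%N)).
  apply: (@sa_ext _ (fun e => exists y, y < e 0%N /\
      forall s, (y < s /\ s < e 0%N) -> g s <= g (e 0%N))).
    move=> e; split=> -[y]; first by case=> xy h; exists y => // s /andP; exact: h.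
    by move=> xy h; exists y; split=> // s /andP; exact: h.
  apply: sa_ex; apply: sa_and; first exact: sa_lt.
  apply: sa_forall; apply: sa_imp; last exact: sa_fun_le.
  by apply: sa_and; exact: sa_lt.
have [b ab hR] := sa_tame_right (fun=> 0) a sR.
have [b' ab' hL] := sa_tame_right (fun=> 0) a sL.
have aB : a < Num.min b b' by rewrite lt_min ab.
exists (Num.min b b') => //.
have m x : a < x < Num.min b b' -> a < x < b /\ a < x < b'.
  by rewrite lt_min => /andP[-> /andP[-> ->]].
case: hR hL => hR [] hL.
- by left; apply: local_nondecreasing => x /m[/hR ? /hL].
- case: (@not_everywhere_local_min g _ _ aB) => x /m[/hR ? /hL nl].
  by split=> //; case: (dL x).
- case: (@not_everywhere_local_max g _ _ aB) => x /m[/hR nr /hL ?].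
  by split=> //; case: (dR x).
- right; apply: local_nonincreasing => x /m[/hR nr /hL nl].
  by case: (dR x); case: (dL x).
Qed.

End Definable.
End Monotonicity.

(** * Semialgebraic selection *)

Section Selection.
Variable R : realType.

Lemma polv_ren d (c : nat -> nat) (V : (nat -> R) -> 'rV[R]_d) :
  polv V -> polv (fun e => V (fun i => e (c i))).
Proof. by move=> pV i; exact: pol_ren (pV i). Qed.

Lemma polv_vars d (c : nat -> nat) : polv (fun e => \row_(i < d) e (c i) : 'rV[R]_d).
Proof. by move=> i; apply: pol_ext (pol_var R (c i)) => e; rewrite mxE. Qed.

Lemma polv_lsubmx d k (V : (nat -> R) -> 'rV[R]_(d + k)) :
  polv V -> polv (fun e => lsubmx (V e)).
Proof. by move=> pV i; apply: pol_ext (pV (lshift k i)) => e; rewrite mxE. Qed.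

Lemma polv_rsubmx d k (V : (nat -> R) -> 'rV[R]_(d + k)) :
  polv V -> polv (fun e => rsubmx (V e)).
Proof. by move=> pV i; apply: pol_ext (pV (rshift d i)) => e; rewrite mxE. Qed.

Definition argmins d (c : 'rV[R]_d -> R) (A : set 'rV[R]_d) : set 'rV[R]_d :=
  [set u | A u /\ forall w, A w -> c u <= c w].

Fixpoint lexmin d (s : seq 'I_d) (A : set 'rV[R]_d) : set 'rV[R]_d :=
  if s is i :: s' then lexmin s' (argmins (fun u => u 0 i) A) else A.

Lemma lexmin_sub d (s : seq 'I_d) A : lexmin s A `<=` A.
Proof. by elim: s A => [|i s IH] A u //= /IH[]. Qed.

Lemma lexmin_coord d (s : seq 'I_d) A u w i :
  i \in s -> lexmin s A u -> lexmin s A w -> u 0 i = w 0 i.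
Proof.
elim: s A => //= j s IH A; rewrite inE => /predU1P[->|i_s]; last exact: IH.
move=> /lexmin_sub[Au mu] /lexmin_sub[Aw mw].
by apply/eqP; rewrite eq_le mu ?mw.
Qed.

Lemma lexmin_inj d A (u w : 'rV[R]_d) :
  lexmin (enum 'I_d) A u -> lexmin (enum 'I_d) A w -> u = w.
Proof.
by move=> lu lw; apply/rowP => i; apply: lexmin_coord lu lw; rewrite mem_enum.
Qed.

Lemma closed_le_fun (T : topologicalType) (c : T -> R) (y : R) :
  continuous c -> closed [set u | c u <= y].
Proof.
by move=> cc; apply: (@preimage_closed _ _ c [set x | x <= y]) => [u _|];
  [exact: cc|exact: closed_le].
Qed.

(** Compactness is asked of one sublevel only, because the set of proximal pairs may be unbounded in
    the subgradient. *)
Lemma argmins_compact d (c : 'rV[R]_d -> R) A u0 : continuous c -> A u0 ->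
  compact (A `&` [set u | c u <= c u0]) ->
  argmins c A !=set0 /\ compact (argmins c A).
Proof.
move=> cc Au0 cK.
have K0 : A `&` [set u | c u <= c u0] !=set0 by exists u0; split=> /=.
have [u + umin] := EVT_min_rV K0 cK (continuous_subspaceT cc).
rewrite inE => -[/= Au uu0].
have umin' w : A w -> c u <= c w.
  move=> Aw; have [wu0|/ltW] := leP (c w) (c u0); last exact: le_trans.
  by apply: umin; rewrite inE.
have -> : argmins c A = (A `&` [set u | c u <= c u0]) `&` [set w | c w <= c u].
  apply/seteqP; split=> w; first by move=> [Aw mw]; do 2?split=> //=; exact: mw.
  by move=> [[Aw _] /= wu]; split=> // w' /umin'; exact: le_trans.
split; first by exists u; do 2?split=> //=.
by apply: compact_closedI => //; exact: closed_le_fun.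
Qed.

Lemma lexmin_nonempty d (s : seq 'I_d) A :
  A !=set0 -> compact A -> lexmin s A !=set0.
Proof.
elim: s A => //= i s IH A [u Au] cA.
have ci : continuous (fun w : 'rV[R]_d => w 0 i) by exact: coord_continuous.
have [|ne cm] := argmins_compact ci Au; last exact: IH.
by apply: compact_closedI => //; exact: closed_le_fun.
Qed.

Section Families.
Variables (d : nat) (A : R -> set 'rV[R]_d).

Definition sa_family := forall p V, pol p -> polv V -> sa (fun e => A (p e) (V e)).

Definition polfun (c : 'rV[R]_d -> R) := forall V, polv V -> pol (fun e => c (V e)).

Lemma polfun_coord i : polfun (fun u => u 0 i).
Proof. by move=> V; exact. Qed.

End Families.

Lemma sa_argmins d (A : R -> set 'rV[R]_d) c :
  polfun c -> sa_family A -> sa_family (fun r => argmins c (A r)).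
Proof.
move=> pc sA p V pp pV; apply: sa_and; first exact: sA.
apply: sa_forallv; apply: sa_imp.
  by apply: sA; [exact: pol_ren pp | exact: (polv_vars id)].
by apply: sa_le; apply: pc; [exact: polv_ren pV | exact: (polv_vars id)].
Qed.

Lemma sa_lexmin d (s : seq 'I_d) (A : R -> set 'rV[R]_d) :
  sa_family A -> sa_family (fun r => lexmin s (A r)).
Proof.
elim: s A => //= i s IH A sA; apply: (IH (fun r => argmins (fun u => u 0 i) (A r))).
exact: sa_argmins (@polfun_coord _ _) sA.
Qed.

(* Choosing the lexicographic minimum of a compact set is a definable selection. *)
Definition lexsel d (A : set 'rV[R]_d) : 'rV[R]_d :=
  xget 0 (lexmin (enum 'I_d) A).

Lemma lexselP d (A : set 'rV[R]_d) : A !=set0 -> compact A -> A (lexsel A).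
Proof.
move=> A0 cA; apply: (@lexmin_sub _ (enum 'I_d)); apply: xgetPex.
exact: lexmin_nonempty.
Qed.

Lemma sa_lexsel d (A : R -> set 'rV[R]_d) c :
  polfun c -> sa_family A -> sa (fun e => c (lexsel (A (e 0%N))) = e 1%N).
Proof.
move=> pc /(sa_lexmin (enum 'I_d)).
set B := fun r => lexmin (enum 'I_d) (A r) => sB.
pose Q (e : nat -> R) := exists u, B (e 0%N) u.
have pv i : pol (fun e : nat -> R => e i) by exact: pol_var.
have sQ : sa Q.
  by apply: sa_exv; apply: sB; [exact: pol_var | exact: (polv_vars id)].
(* The second disjunct accounts for the default value 0 of [xget] on parameters where the set of
   minimizers is empty. *)
apply: (@sa_ext _ (fun e => (exists u, B (e 0%N) u /\ c u = e 1%N) \/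
    (~ Q e /\ c 0 = e 1%N))); last first.
  apply: sa_or.
    apply: sa_exv; apply: sa_and.
      by apply: sB; [exact: pol_var | exact: (polv_vars id)].
    by apply: sa_eq; [apply: pc; exact: (polv_vars id) | exact: pol_var].
  apply: sa_and; first exact: sa_not.
  by apply: sa_eq; [exact: pol_const | exact: pol_var].
move=> e; rewrite /lexsel -/(B (e 0%N)); case: xgetP => [u _ Bu|nB].
  split=> [[[w [Bw <-]]|[nQ _]]|<-].
  - by rewrite (lexmin_inj Bu Bw).
  - by case: nQ; exists u.
  - by left; exists u.
split=> [[[w [Bw _]]|[_ //]]|<-]; first by case: (nB w).
by right; split=> // -[w /nB].
Qed.

End Selection.

(** * Euclidean norm *)

Section Euclidean.
Variable R : realType.
Implicit Types (d k : nat) (a : R).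

Lemma dotpC d (u v : 'rV[R]_d) : dotp u v = dotp v u.
Proof. by apply: eq_bigr => i _; rewrite mulrC. Qed.

Lemma dotpDl d (u v w : 'rV[R]_d) : dotp (u + v) w = dotp u w + dotp v w.
Proof. by rewrite -big_split; apply: eq_bigr => i _; rewrite mxE mulrDl. Qed.

Lemma dotpDr d (u v w : 'rV[R]_d) : dotp u (v + w) = dotp u v + dotp u w.
Proof. by rewrite dotpC dotpDl !(dotpC u). Qed.

Lemma dotpZl d a (u v : 'rV[R]_d) : dotp (a *: u) v = a * dotp u v.
Proof. by rewrite /dotp mulr_sumr; apply: eq_bigr => i _; rewrite mxE mulrA. Qed.

Lemma dotpZr d a (u v : 'rV[R]_d) : dotp u (a *: v) = a * dotp u v.
Proof. by rewrite dotpC dotpZl dotpC. Qed.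

Lemma dotpNl d (u v : 'rV[R]_d) : dotp (- u) v = - dotp u v.
Proof. by rewrite -scaleN1r dotpZl mulN1r. Qed.

Lemma dotpNr d (u v : 'rV[R]_d) : dotp u (- v) = - dotp u v.
Proof. by rewrite dotpC dotpNl dotpC. Qed.

Lemma dotp0l d (u : 'rV[R]_d) : dotp 0 u = 0.
Proof. by rewrite -(scale0r 0) dotpZl mul0r. Qed.

Lemma dotp0r d (u : 'rV[R]_d) : dotp u 0 = 0.
Proof. by rewrite dotpC dotp0l. Qed.

Lemma dotp_ge0 d (u : 'rV[R]_d) : 0 <= dotp u u.
Proof. by apply: sumr_ge0 => i _; rewrite -expr2 sqr_ge0. Qed.

Lemma dotp_eq0 d (u : 'rV[R]_d) : dotp u u = 0 -> u = 0.
Proof.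
move=> /eqP; rewrite psumr_eq0 => [/allP u0|i _]; last by rewrite -expr2 sqr_ge0.
apply/rowP => i; have := u0 i; rewrite mem_index_enum mxE => /(_ isT).
by rewrite -expr2 sqrf_eq0 => /eqP.
Qed.

Lemma enorm_ge0 d (u : 'rV[R]_d) : 0 <= enorm u.
Proof. exact: sqrtr_ge0. Qed.

Lemma enorm_sqr d (u : 'rV[R]_d) : enorm u ^+ 2 = dotp u u.
Proof. by rewrite sqr_sqrtr ?dotp_ge0. Qed.

Lemma enorm0 d : enorm (0 : 'rV[R]_d) = 0.
Proof. by rewrite /enorm dotp0l sqrtr0. Qed.

Lemma enorm0_eq0 d (u : 'rV[R]_d) : enorm u = 0 -> u = 0.
Proof. by move=> u0; apply: dotp_eq0; rewrite -enorm_sqr u0 expr0n. Qed.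

Lemma enormZ d a (u : 'rV[R]_d) : enorm (a *: u) = `|a| * enorm u.
Proof.
by rewrite /enorm dotpZl dotpZr mulrA -expr2 sqrtrM ?sqr_ge0 // sqrtr_sqr.
Qed.

Lemma enormN d (u : 'rV[R]_d) : enorm (- u) = enorm u.
Proof. by rewrite -scaleN1r enormZ normrN1 mul1r. Qed.

Lemma dotp_le d (u v : 'rV[R]_d) : dotp u v <= enorm u * enorm v.
Proof.
have [v0|v0] := eqVneq v 0; first by rewrite v0 dotp0r enorm0 mulr0.
have B0 : 0 < dotp v v.
  by rewrite lt_neqAle dotp_ge0 eq_sym andbT; apply: contra_neqN v0 => /eqP/dotp_eq0.
(* The part of u orthogonal to v, multiplied by |v|^2 to avoid a division. *)
have := dotp_ge0 (dotp v v *: u - dotp u v *: v).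
have -> : dotp (dotp v v *: u - dotp u v *: v) (dotp v v *: u - dotp u v *: v)
    = dotp v v * (dotp u u * dotp v v - dotp u v ^+ 2).
  by rewrite !(dotpDl, dotpDr, dotpNl, dotpNr, dotpZl, dotpZr) (dotpC v u); ring.
rewrite pmulr_rge0 // subr_ge0 => CS.
apply: le_trans (ler_norm _) _.
by rewrite -sqrtr_sqr /enorm -sqrtrM ?dotp_ge0 // ler_wsqrtr.
Qed.

Lemma dotp_ge d (u v : 'rV[R]_d) : - (enorm u * enorm v) <= dotp u v.
Proof. by rewrite lerNl -dotpNl -(enormN u) dotp_le. Qed.

Lemma enormD d (u v : 'rV[R]_d) : enorm (u + v) <= enorm u + enorm v.
Proof.
rewrite -(@ler_pXn2r _ 2) ?nnegrE ?addr_ge0 ?enorm_ge0 //.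
rewrite sqrrD !enorm_sqr dotpDl !dotpDr (dotpC v u).
have := dotp_le u v; lra.
Qed.

Lemma enorm_coord d (u : 'rV[R]_d) i : `|u 0 i| <= enorm u.
Proof.
rewrite -sqrtr_sqr ler_wsqrtr // /dotp (bigD1 i) //= -expr2 lerDl.
by apply: sumr_ge0 => j _; rewrite -expr2 sqr_ge0.
Qed.

Lemma enorm_le_sum d (u : 'rV[R]_d) : enorm u <= \sum_i `|u 0 i|.
Proof.
have S0 : 0 <= \sum_i `|u 0 i| by apply: sumr_ge0.
rewrite -(@ler_pXn2r _ 2) ?nnegrE ?enorm_ge0 // enorm_sqr expr2 mulr_suml.
apply: ler_sum => i _; rewrite -expr2 -real_normK ?num_real // expr2.
by apply: ler_wpM2l => //; rewrite (bigD1 i) //= lerDl sumr_ge0.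
Qed.

Lemma dotp_row_mx d k (u u' : 'rV[R]_d) (v v' : 'rV[R]_k) :
  dotp (row_mx u v) (row_mx u' v') = dotp u u' + dotp v v'.
Proof.
by rewrite /dotp big_split_ord /=; congr (_ + _); apply: eq_bigr => i _;
  rewrite ?row_mxEl ?row_mxEr.
Qed.

Lemma enorm_row_mxl d k (u : 'rV[R]_d) (v : 'rV[R]_k) : enorm u <= enorm (row_mx u v).
Proof. by rewrite ler_wsqrtr // dotp_row_mx lerDl dotp_ge0. Qed.

Lemma enorm_row_mxr d k (u : 'rV[R]_d) (v : 'rV[R]_k) : enorm v <= enorm (row_mx u v).
Proof. by rewrite ler_wsqrtr // dotp_row_mx lerDr dotp_ge0. Qed.

Lemma enorm_row_mx_le d k (u : 'rV[R]_d) (v : 'rV[R]_k) :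
  enorm (row_mx u v) <= enorm u + enorm v.
Proof.
rewrite -(@ler_pXn2r _ 2) ?nnegrE ?addr_ge0 ?enorm_ge0 //.
rewrite sqrrD !enorm_sqr dotp_row_mx addrAC lerDl mulrn_wge0 // mulr_ge0 //;
  exact: enorm_ge0.
Qed.

Lemma lsubmx_continuous d k : continuous (fun u : 'rV[R]_(d + k) => lsubmx u).
Proof.
move=> u s /nbhs_ballP[e e0 es]; apply/nbhs_ballP; exists e => // w uw.
by apply: es; split=> // i j; rewrite !mxE; exact: uw.2.
Qed.

Lemma rsubmx_continuous d k : continuous (fun u : 'rV[R]_(d + k) => rsubmx u).
Proof.
move=> u s /nbhs_ballP[e e0 es]; apply/nbhs_ballP; exists e => // w uw.
by apply: es; split=> // i j; rewrite !mxE; exact: uw.2.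
Qed.

Lemma dotp_continuous (T : topologicalType) d (V W : T -> 'rV[R]_d) :
  continuous V -> continuous W -> continuous (fun x => dotp (V x) (W x)).
Proof.
move=> cV cW; apply: continuous_big => [|i _ x]; first exact: add_continuous.
apply: cvgM; apply: (@continuous_comp _ _ _ _ (fun u : 'rV[R]_d => u 0 i));
  by [exact: cV | exact: cW | exact: coord_continuous].
Qed.

Lemma closed_forall (T : topologicalType) I (P : I -> set T) :
  (forall i, closed (P i)) -> closed [set x | forall i, P i x].
Proof.
move=> cP; have -> : [set x | forall i, P i x] = \bigcap_i P i.
  by apply/seteqP; split=> x h i; [move=> _|]; exact: h.
exact: closed_bigI.
Qed.

End Euclidean.

(** * The Kurdyka-Lojasiewicz inequality *)

Section KL.
Variables (R : realType) (N : nat) (F : 'rV[R]_N -> \bar R) (M C : R).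
Hypothesis F_sa : semialgebraic F.
Hypothesis F_closed : forall r, closed [set z | (F z <= r%:E)%E].
Hypothesis F_ninfty : forall z, (-oo < F z)%E.
Hypothesis C0 : 0 <= C.

Definition box d (B : R) : set 'rV[R]_d := [set z | forall i, `|z 0 i| <= B].

(* Encodes the pairs (z, v) as row vectors: v is a proximal subgradient of F at
   z, on the level F z = r, with curvature constant C valid on the whole box. *)
Definition psub (r : R) : set 'rV[R]_(N + N) :=
  [set u | [/\ box M (lsubmx u), F (lsubmx u) = r%:E &
    forall w t, box M w -> F w = t%:E ->
      r + dotp (rsubmx u) (w - lsubmx u) -
        C * dotp (w - lsubmx u) (w - lsubmx u) <= t]].

Lemma box_compact d B : compact (@box d B).
Proof.
have -> : @box d B = [set z | forall i, (`[- B, B]%classic : set R) (z ord0 i)].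
  by apply/seteqP; split=> z h i; have := h i; rewrite /= in_itv /= -ler_norml.
by apply: (@rV_compact _ _ (fun=> `[- B, B]%classic)) => _; exact: segment_compact.
Qed.

Lemma closed_box d B : closed (@box d B).
Proof. by apply: compact_closed; [exact: norm_hausdorff | exact: box_compact]. Qed.

Lemma closed_preimage_continuous (T U : topologicalType) (f : T -> U) (D : set U) :
  continuous f -> closed D -> closed (f @^-1` D).
Proof. by move=> cf; apply: preimage_closed => x _; exact: cf. Qed.

(* Lower semicontinuity suffices for the level equation to pass to the limit,
   because the inequality at w = z gives r <= F z. *)
Lemma closed_psub r : closed (psub r).
Proof.
have -> : psub r = (fun u => lsubmx u) @^-1` @box N M `&`
    (fun u => lsubmx u) @^-1` [set z | (F z <= r%:E)%E] `&`
    [set u | forall wt : {wt : 'rV[R]_N * R | box M wt.1 /\ F wt.1 = wt.2%:E},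
      r + dotp (rsubmx u) ((sval wt).1 - lsubmx u) -
        C * dotp ((sval wt).1 - lsubmx u) ((sval wt).1 - lsubmx u) <= (sval wt).2].
  apply/seteqP; split=> u.
    move=> [bu Fu h]; split; first by split=> //=; rewrite Fu.
    by move=> [[w t] /= [bw Fw]]; exact: h.
  move=> [[/= bu Fu] h].
  have h' w t : box M w -> F w = t%:E -> r + dotp (rsubmx u) (w - lsubmx u) -
      C * dotp (w - lsubmx u) (w - lsubmx u) <= t.
    by move=> bw Fw; exact: (h (exist _ (w, t) (conj bw Fw))).
  split=> //; have := F_ninfty (lsubmx u).
  case E : (F (lsubmx u)) => [t| |] // _; last by rewrite E in Fu.
  have := h' _ _ bu E; rewrite subrr !dotp0r mulr0 addr0 subr0 => rt.
  by congr (_%:E); apply/eqP; rewrite eq_le rt andbT; move: Fu; rewrite E lee_fin.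
apply: closedI; first apply: closedI.
- exact: (closed_preimage_continuous (@lsubmx_continuous _ _ _) (@closed_box _ _)).
- exact: (closed_preimage_continuous (@lsubmx_continuous _ _ _) (@F_closed _)).
apply: closed_forall => -[[w t] /= _]; apply: closed_le_fun.
have ccst (U : topologicalType) (a : U) : continuous (fun _ : 'rV[R]_(N + N) => a).
  by move=> x; exact: cst_continuous.
have cw : continuous (fun u : 'rV[R]_(N + N) => w - lsubmx u).
  by move=> u; exact: (continuousB (@ccst _ w u) (@lsubmx_continuous _ _ _ u)).
have c1 := dotp_continuous (@rsubmx_continuous R N N) cw.
have c2 := dotp_continuous cw cw.
move=> u; exact: (continuousB (continuousD (@ccst _ r u) (c1 u))
  (continuousM (@ccst _ C u) (c2 u))).
Qed.

Definition slope2 (u : 'rV[R]_(N + N)) : R := dotp (rsubmx u) (rsubmx u).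

Lemma slope2_continuous : continuous slope2.
Proof. by apply: dotp_continuous; exact: rsubmx_continuous. Qed.

Lemma psub_sublevel_compact r B :
  compact (psub r `&` [set u | slope2 u <= B]).
Proof.
apply: (subclosed_compact _ (@box_compact (N + N) (Num.max M (Num.sqrt B)))).
  by apply: closedI; [exact: closed_psub | exact: closed_le_fun slope2_continuous].
move=> u [[bu _ _] uB] i; rewrite le_max; apply/orP.
rewrite -[i]splitK; case: (fintype.split i) => j /=.
  by left; have := bu j; rewrite mxE.
right; apply: (@le_trans _ _ (enorm (rsubmx u))); last by rewrite ler_wsqrtr.
by have := enorm_coord (rsubmx u) j; rewrite mxE.
Qed.

Definition flattest (r : R) := argmins slope2 (psub r).

(** The thalweg, or valley line, of F: it crosses each level at a point of least slope. The
    lexicographic choice makes it a definable function of the level. *)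
Definition talweg (r : R) := lexsel (flattest r).

Lemma talwegP r u : psub r u ->
  psub r (talweg r) /\ forall w, psub r w -> slope2 (talweg r) <= slope2 w.
Proof.
move=> pu; have [ne cm] := argmins_compact slope2_continuous pu
  (@psub_sublevel_compact _ _).
exact: (lexselP ne cm).
Qed.

Lemma sa_box d B V : polv V -> sa (fun e => @box d B (V e)).
Proof.
move=> pV; apply: sa_all_fin => i.
apply: (@sa_ext _ (fun e => - B <= V e 0 i /\ V e 0 i <= B)).
  by move=> e; rewrite ler_norml; split=> [[-> ->]|/andP].
by apply: sa_and; apply: sa_le => //; exact: pol_const.
Qed.

Lemma sa_psub : sa_family psub.
Proof.
move=> p V pp pV.
apply: (@sa_ext _ (fun e => box M (lsubmx (V e)) /\ F (lsubmx (V e)) = (p e)%:E /\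
   forall w t, box M w -> F w = t%:E ->
      p e + dotp (rsubmx (V e)) (w - lsubmx (V e)) -
        C * dotp (w - lsubmx (V e)) (w - lsubmx (V e)) <= t)).
  by move=> e; split=> [[? [? ?]]|[? ? ?]].
apply: sa_and; first by apply: sa_box; exact: polv_lsubmx.
apply: sa_and; first by apply: sa_semialgebraic => //; exact: polv_lsubmx.
apply: sa_forallv; apply: sa_forall.
(* Variable 0 is [t], variables 1 to N are [w], and the former environment starts at N + 1. *)
have pw : polv (fun e => \row_(i < N) e i.+1 : 'rV[R]_N) by exact: (polv_vars R succn).
have pV' : polv (fun e => V (fun i => e (N + i).+1)) by exact: polv_ren pV.
have pwV : polv (fun e => \row_(i < N) e i.+1 - lsubmx (V (fun i => e (N + i).+1))).
  by apply: polv_sub => //; exact: polv_lsubmx.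
apply: sa_imp; first exact: sa_box.
apply: sa_imp; first by apply: sa_semialgebraic => //; exact: pol_var.
apply: sa_le; last exact: pol_var.
apply: pol_sub; last by apply: pol_mul; [exact: pol_const | exact: pol_dotp].
apply: pol_add; first exact: pol_ren pp.
by apply: pol_dotp => //; exact: polv_rsubmx.
Qed.

Lemma polfun_slope2 : polfun slope2.
Proof. by move=> V pV; apply: pol_dotp; exact: polv_rsubmx. Qed.

Lemma sa_talweg c : polfun c -> sa (fun e => c (talweg (e 0%N)) = e 1%N).
Proof. by move=> pc; apply: sa_lexsel pc _; exact: sa_argmins polfun_slope2 sa_psub. Qed.

(* v is a subgradient at z(u) and F (z(u')) = u', so the drop u - u' is at most
   |v| |z(u) - z(u')| up to a quadratic error; Frechet subgradients thus satisfy
   the chain rule along the curve for free. *)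
Lemma talweg_drop r s u w : psub r u -> psub s w ->
  s - r <= (Num.sqrt (slope2 w) + C * \sum_i `|lsubmx w 0 i - lsubmx u 0 i|) *
    \sum_i `|lsubmx w 0 i - lsubmx u 0 i|.
Proof.
move=> [bu Fu _] [_ _ hw].
set S := \sum_i _; set z := lsubmx w; set z' := lsubmx u.
have dS : enorm (z' - z) <= S.
  apply: le_trans (enorm_le_sum _) _; apply: ler_sum => i _.
  by rewrite !mxE distrC.
have S0 : 0 <= S by exact: sumr_ge0.
have := hw _ _ bu Fu; rewrite -/z -/z' -enorm_sqr => h.
have h1 := dotp_ge (rsubmx w) (z' - z).
have h2 : enorm (rsubmx w) * enorm (z' - z) <= enorm (rsubmx w) * S.
  by rewrite ler_wpM2l // enorm_ge0.
have h3 : C * enorm (z' - z) ^+ 2 <= C * S ^+ 2.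
  by rewrite ler_wpM2l // ler_pXn2r // nnegrE enorm_ge0.
rewrite -/(enorm (rsubmx w)) mulrDl -mulrA -expr2; lra.
Qed.

End KL.

(** * Integration along the valley line *)

Section IntegratedKL.
Variable R : realType.

(* Subdividing [t, s] makes the quadratic term negligible, except on the pieces
   where phi jumps, and there the linear bound is trivial; no continuity of phi
   is needed. *)
Lemma linear_of_quadratic_drop (phi : R -> R) (t s m C : R) :
  0 <= m -> 0 <= C -> t <= s ->
  (forall v u, t <= v -> v <= u -> u <= s -> phi v <= phi u /\
     u - v <= (m + C * (phi u - phi v)) * (phi u - phi v)) ->
  s - t <= m * (phi s - phi t).
Proof.
move=> m0 C0 ts loc.
have St : 0 <= phi s - phi t by rewrite subr_ge0; apply: (loc _ _ _ ts _).1.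
suff key e : 0 < e -> s - t <= (m + e) * (phi s - phi t).
  apply/ler_addgt0Pr => e e0.
  have p0 : 0 < phi s - phi t + 1 by rewrite ltr_wpDl.
  apply: le_trans (key (e / (phi s - phi t + 1)) (divr_gt0 e0 p0)) _.
  rewrite mulrDl lerD2l mulrAC ler_pdivrMr //.
  by apply: ler_wpM2l; [exact: ltW | rewrite lerDl].
(* Below a rise of [e / (C + 1)], C times the rise of phi is at most e and is absorbed by [m + e];
   above it, a piece of length at most [l] satisfies the linear bound at once. *)
move=> e0; pose l := (m + e) * (e / (C + 1)).
have C1 : 0 < C + 1 by rewrite ltr_wpDl.
have me : 0 < m + e by rewrite ltr_wpDl.
have l0 : 0 < l by rewrite mulr_gt0 // divr_gt0.
have small n v u : t <= v -> v <= u -> u <= s -> u - v <= 2 ^+ n * l ->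
    u - v <= (m + e) * (phi u - phi v).
  elim: n v u => [|n IH] v u tv vu us.
    have [vp /le_trans drop] := loc v u tv vu us.
    rewrite expr0 mul1r => uvl.
    have [Se|Se] := leP (phi u - phi v) (e / (C + 1)); last first.
      by apply: le_trans uvl _; rewrite ler_wpM2l ?(ltW me) // ltW.
    apply: drop; rewrite ler_wpM2r ?subr_ge0 // lerD2l.
    move: Se; rewrite ler_pdivlMr // => Se.
    have : 0 <= phi u - phi v by rewrite subr_ge0.
    by lra.
  rewrite exprS => uvl; pose c := (v + u) / 2.
  have h1 : c - v <= (m + e) * (phi c - phi v).
    by apply: IH; rewrite ?/c //; lra.
  have h2 : u - c <= (m + e) * (phi u - phi c).
    by apply: IH; rewrite ?/c //; lra.
  by lra.
pose k := Num.bound ((s - t) / l).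
apply: (small k) => //; rewrite -ler_pdivrMr //.
have : (s - t) / l < k%:R.
  by apply: archi_boundP; rewrite divr_ge0 ?subr_ge0 // ltW.
move/ltW/le_trans; apply; rewrite -natrX ler_nat.
by rewrite ltnW // ltn_expl.
Qed.

Lemma eventually_right_all d (a : R) (P : 'I_d -> R -> Prop) :
  (forall i, exists2 b, a < b & P i b) ->
  (forall i b b', b' <= b -> P i b -> P i b') ->
  exists2 b, a < b & forall i, P i b.
Proof.
move=> ex anti.
have {ex} [b bP] := choice (fun i => let: ex_intro2 b ab Pb := ex i in
  ex_intro (fun b => a < b /\ P i b) b (conj ab Pb)).
exists (\big[Num.min/a + 1]_i b i).
  by apply: lt_bigmin => [|i _]; [rewrite ltrDl | exact: (bP i).1].
by move=> i; apply: anti (bP i).2; exact: bigmin_le.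
Qed.

Variables (N : nat) (F : 'rV[R]_N -> \bar R) (M C : R).
Hypothesis F_sa : semialgebraic F.
Hypothesis F_closed : forall r, closed [set z | (F z <= r%:E)%E].
Hypothesis F_ninfty : forall z, (-oo < F z)%E.
Hypothesis C0 : 0 <= C.

(* Kurdyka-Lojasiewicz inequality at the level a: phi is the desingularizing
   function, with s - t <= |v| (phi s - phi t) replacing phi'(s) |v| >= 1. *)
Theorem integrated_KL (a : R) :
  (forall e b, 0 < e -> a < b ->
     exists r u, [/\ a < r < b, psub F M C r u & slope2 u < e]) ->
  exists b (phi : R -> R) B, [/\ a < b, (forall r, a < r < b -> `|phi r| <= B),
    (forall t s, a < t -> t <= s -> s < b -> phi t <= phi s) &
    forall t s u, a < t -> t <= s -> s < b -> psub F M C s u ->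
      s - t <= enorm (rsubmx u) * (phi s - phi t)].
Proof.
move=> crit.
pose T := talweg F M C; pose mu r := slope2 (T r).
have TP r u : psub F M C r u ->
    psub F M C r (T r) /\ forall w, psub F M C r w -> mu r <= slope2 w.
  exact: talwegP.
have pv i : pol (fun e : nat -> R => e i) by exact: pol_var.
have [b1 ab1 ex1] : exists2 b, a < b & forall r, a < r < b -> psub F M C r (T r).
  have sne : sa (fun e => exists u, psub F M C (e 0%N) u).
    by apply: sa_exv; apply: sa_psub => //; exact: (polv_vars R id).
  have [b ab [h|h]] := sa_tame_right (fun=> 0) a sne.
    by exists b => // r /h[u /TP[]].
  have [r [u [arb pu _]]] := crit 1 b ltr01 ab.
  by case: (h r arb); exists u.
have [b2 ab2 mono_mu] : exists2 b, a < b &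
    forall r s, a < r -> r <= s -> s < b -> mu r <= mu s.
  have smu : sa (fun e => mu (e 0%N) = e 1%N).
    by apply: sa_talweg => //; exact: polfun_slope2.
  have [b ab [h|h]] := sa_monotone_right smu a; first by exists b.
  (* If [mu] is nonincreasing near [a], then [mu r] is below the arbitrarily small slopes that
     [crit] supplies at levels between [a] and [r]. So [mu] vanishes there and is trivially
     nondecreasing. *)
  have ab' : a < Num.min b b1 by rewrite lt_min ab.
  exists (Num.min b b1) => // r s ar rs; rewrite lt_min => /andP[sb _].
  apply: (@le_trans _ _ 0); last exact: dotp_ge0.
  apply/ler_addgt0Pr => e e0; rewrite add0r.
  have [q [u [/andP[aq qr] pu ue]]] := crit e r e0 ar.
  apply: le_trans (ltW ue); apply: le_trans ((TP _ _ pu).2 _ pu).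
  by apply: h => //; [exact: ltW | exact: le_lt_trans sb].
pose z r (i : 'I_N) := lsubmx (T r) 0 i.
have [b3 ab3 mono_z] : exists2 b, a < b & forall i : 'I_N,
    (forall r s, a < r -> r <= s -> s < b -> z r i <= z s i) \/
    (forall r s, a < r -> r <= s -> s < b -> z s i <= z r i).
  apply: eventually_right_all => [i|i b b' bb' [h|h]].
  - apply: (@sa_monotone_right _ (fun r => z r i)).
    apply: (@sa_talweg _ _ F M C F_sa (fun u => lsubmx u 0 i)).
    by move=> V pV; exact: (polv_lsubmx pV).
  - by left=> r s ar rs sb; apply: h => //; exact: lt_le_trans bb'.
  - by right=> r s ar rs sb; apply: h => //; exact: lt_le_trans bb'.
have sign i : exists c : R, `|c| = 1 /\ forall r s, a < r -> r <= s -> s < b3 ->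
    `|z s i - z r i| = c * z s i - c * z r i.
  case: (mono_z i) => h; [exists 1 | exists (-1)]; rewrite ?normrN1 ?normr1; split=> //.
    by move=> r s ar rs sb; rewrite !mul1r ger0_norm // subr_ge0 h.
  move=> r s ar rs sb; rewrite !mulN1r ler0_norm ?subr_le0 ?h //.
  by rewrite opprB opprK addrC.
have {sign} [sg sgP] := choice sign.
(* The signs make every coordinate nondecreasing, so that absolute increments add up to an increment
   of [phi]. *)
pose phi r := \sum_i sg i * z r i.
have phiB r s : a < r -> r <= s -> s < b3 -> \sum_i `|z s i - z r i| = phi s - phi r.
  move=> ar rs sb; rewrite /phi -sumrB; apply: eq_bigr => i _.
  exact: (sgP i).2.
pose b := Num.min b1 (Num.min b2 b3).
have ab : a < b by rewrite !lt_min ab1 ab2.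
exists b, phi, (N%:R * M); split=> //.
  move=> r /andP[ar]; rewrite !lt_min => /andP[rb1 _].
  have [bT _ _] := ex1 r (introT andP (conj ar rb1)).
  apply: le_trans (ler_norm_sum _ _ _) _.
  rewrite -[N in N%:R]card_ord -sum1_card natr_sum mulr_suml.
  apply: ler_sum => i _.
  by rewrite mul1r normrM (sgP i).1 mul1r; exact: bT.
  move=> t s at_ ts; rewrite !lt_min => /andP[_ /andP[_ sb3]].
  by rewrite -subr_ge0 -phiB // sumr_ge0.
move=> t s u at_ ts; rewrite !lt_min => /andP[sb1 /andP[sb2 sb3]] pu.
have as_ : a < s by exact: lt_le_trans ts.
have muu : Num.sqrt (mu s) <= enorm (rsubmx u).
  by rewrite ler_wsqrtr // (TP _ _ pu).2.
have phi_ts : 0 <= phi s - phi t by rewrite -phiB // sumr_ge0.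
apply: le_trans (ler_wpM2r phi_ts muu).
(* As [mu] is nondecreasing, the least slope at level [s] bounds those on all of [t, s] and can
   serve as the constant m. *)
apply: (@linear_of_quadratic_drop phi t s (Num.sqrt (mu s)) C) => //.
move=> v w tv vw ws.
have av : a < v by exact: lt_le_trans tv.
have wb3 : w < b3 by exact: le_lt_trans sb3.
have S0 : 0 <= phi w - phi v by rewrite -phiB // sumr_ge0.
split; first by rewrite -subr_ge0.
have aw : a < w by exact: lt_le_trans vw.
have pT q : a < q -> q <= w -> psub F M C q (T q).
  by move=> aq qw; apply: ex1; rewrite aq (le_lt_trans qw) // (le_lt_trans ws).
have := talweg_drop C0 (pT v av vw) (pT w aw (lexx w)).
rewrite (phiB v w av vw wb3) => /le_trans; apply.
apply: ler_wpM2r => //; rewrite lerD2r ler_wsqrtr //.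
by apply: mono_mu.
Qed.

End IntegratedKL.

(** * Descent estimates and proximal steps *)

Section Calculus.
Variable R : realType.

Lemma derive_dotp_grad d (G : 'rV[R]_d -> R) u v :
  differentiable G u -> 'D_v G u = dotp (grad G u) v.
Proof.
move=> dG; rewrite deriveE // {1}[v]row_sum_delta linear_sum /=.
by apply: eq_bigr => i _; rewrite linearZ /= mxE -deriveE // mulrC.
Qed.

Lemma mean_value d (G : 'rV[R]_d -> R) z v :
  (forall u, differentiable G u) ->
  exists2 c, 0 <= c <= 1 & G (z + v) - G z = dotp (grad G (z + c *: v)) v.
Proof.
move=> dG; pose g (t : R) := G (z + t *: v).
have quot (t : R) : (fun h : R => h^-1 *: ((g \o shift t) (h *: 1) - g t)) =
    (fun h => h^-1 *: ((G \o shift (z + t *: v)) (h *: v) - G (z + t *: v))).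
  apply/funext => h; congr (_ *: (G _ - _)) => /=.
  by rewrite /GRing.scale /= mulr1 -/(_ *: _) scalerDl addrCA.
have der (t : R) : is_derive t (1 : R) g (dotp (grad G (z + t *: v)) v).
  split; first by rewrite /derivable quot; exact: diff_derivable.
  by rewrite /derive quot -derive_dotp_grad.
have [|c] := MVT_segment (@ler01 R) (fun t _ => der t).
  by apply: derivable_within_continuous => t _; case: (der t).
rewrite in_itv /= /g scale1r scale0r addr0 subr0 mulr1 => c01 ->.
by exists c.
Qed.

(** The mean value theorem replaces integration of the gradient. It yields L where the sharp
    quadratic bound has L / 2, which affects only constants such as the acceptance threshold of the
    step size. *)
Lemma taylor1 d (G : 'rV[R]_d -> R) z v B :
  (forall u, differentiable G u) ->
  (forall c, 0 <= c <= 1 ->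
     `|dotp (grad G (z + c *: v) - grad G z) v| <= B) ->
  `|G (z + v) - G z - dotp (grad G z) v| <= B.
Proof.
move=> dG; have [c c01 ->] := mean_value z v dG => /(_ c c01).
by rewrite dotpDl dotpNl.
Qed.

Lemma abs_dotp_le d (u v : 'rV[R]_d) : `|dotp u v| <= enorm u * enorm v.
Proof. by rewrite ler_norml dotp_le dotp_ge. Qed.

Variables n m : nat.
Implicit Types (H : 'rV[R]_n -> 'rV[R]_m -> R).

(** A directional derivative sees the function only along a line, so derivatives taken in spaces of
    different dimension can be compared. *)
Lemma derive_eq_along (V V' : normedModType R) (f : V -> R) (f' : V' -> R) a v a' v' :
  (forall h : R, f (h *: v + a) = f' (h *: v' + a')) -> 'D_v f a = 'D_v' f' a'.
Proof.
move=> ff'; rewrite /derive.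
suff -> : (fun h : R => h^-1 *: ((f \o shift a) (h *: v) - f a)) =
  (fun h => h^-1 *: ((f' \o shift a') (h *: v') - f' a')) by [].
apply/funext => h; have := ff' 0; rewrite !scale0r !add0r => ->.
by rewrite /= ff'.
Qed.

Lemma grad_joint H x y :
  grad (joint H) (row_mx x y) = row_mx (gradx H x y) (grady H x y).
Proof.
apply/rowP => i; rewrite -[i]splitK; case: (fintype.split i) => j /=.
  rewrite row_mxEl !mxE; apply: derive_eq_along => h.
  rewrite /joint delta_mx_lshift scale_row_mx add_row_mx.
  by rewrite row_mxKl row_mxKr scaler0 add0r.
rewrite row_mxEr !mxE; apply: derive_eq_along => h.
rewrite /joint delta_mx_rshift scale_row_mx add_row_mx.
by rewrite row_mxKl row_mxKr scaler0 add0r.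
Qed.

Lemma descent_x H L x y w : (forall u, differentiable (joint H) u) ->
  lipschitz_with setT (fun u => gradx H u y) L ->
  H w y <= H x y + dotp (gradx H x y) (w - x) + L * enorm (w - x) ^+ 2.
Proof.
move=> dH [L0 lip]; set B := L * _.
suff : `|joint H (row_mx x y + row_mx (w - x) 0) - joint H (row_mx x y) -
    dotp (grad (joint H) (row_mx x y)) (row_mx (w - x) 0)| <= B.
  rewrite add_row_mx addr0 /joint !(row_mxKl, row_mxKr) grad_joint dotp_row_mx.
  by rewrite dotp0r addr0 (addrC x) subrK ler_norml; lra.
apply: taylor1 => // c /andP[c0 c1].
rewrite scale_row_mx add_row_mx scaler0 addr0 !grad_joint opp_row_mx add_row_mx.
rewrite dotp_row_mx dotp0r addr0; apply: le_trans (abs_dotp_le _ _) _.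
rewrite /B expr2 mulrA; apply: ler_wpM2r; first exact: enorm_ge0.
apply: le_trans (lip _ _ I I) _.
rewrite (addrC x) addrK enormZ ger0_norm // mulrA.
by apply: ler_wpM2r; [exact: enorm_ge0 | rewrite ler_piMr].
Qed.

Lemma descent_y H L x y w : (forall u, differentiable (joint H) u) ->
  lipschitz_with setT (fun v => grady H x v) L ->
  H x w <= H x y + dotp (grady H x y) (w - y) + L * enorm (w - y) ^+ 2.
Proof.
move=> dH [L0 lip]; set B := L * _.
suff : `|joint H (row_mx x y + row_mx 0 (w - y)) - joint H (row_mx x y) -
    dotp (grad (joint H) (row_mx x y)) (row_mx 0 (w - y))| <= B.
  rewrite add_row_mx addr0 /joint !(row_mxKl, row_mxKr) grad_joint dotp_row_mx.
  by rewrite dotp0r add0r (addrC y) subrK ler_norml; lra.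
apply: taylor1 => // c /andP[c0 c1].
rewrite scale_row_mx add_row_mx scaler0 addr0 !grad_joint opp_row_mx add_row_mx.
rewrite dotp_row_mx dotp0r add0r; apply: le_trans (abs_dotp_le _ _) _.
rewrite /B expr2 mulrA; apply: ler_wpM2r; first exact: enorm_ge0.
apply: le_trans (lip _ _ I I) _.
rewrite (addrC y) addrK enormZ ger0_norm // mulrA.
by apply: ler_wpM2r; [exact: enorm_ge0 | rewrite ler_piMr].
Qed.

Lemma box_segment d M (z w : 'rV[R]_d) c : 0 <= c <= 1 ->
  box M z -> box M w -> box M (z + c *: (w - z)).
Proof.
move=> /andP[c0 c1] bz bw i; rewrite !mxE.
have -> : z 0 i + c * (w 0 i - z 0 i) = (1 - c) * z 0 i + c * w 0 i by ring.
apply: le_trans (ler_normD _ _) _; rewrite !normrM (ger0_norm c0) ger0_norm ?subr_ge0 //.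
have h1 : (1 - c) * `|z 0 i| <= (1 - c) * M by rewrite ler_wpM2l ?subr_ge0.
have h2 : c * `|w 0 i| <= c * M by rewrite ler_wpM2l.
lra.
Qed.

Lemma lower_quadratic_box d (G : 'rV[R]_d -> R) M L z w :
  (forall u, differentiable G u) -> lipschitz_with (box M) (grad G) L ->
  box M z -> box M w ->
  G z + dotp (grad G z) (w - z) - L * dotp (w - z) (w - z) <= G w.
Proof.
move=> dG [L0 lip] bz bw.
suff : `|G (z + (w - z)) - G z - dotp (grad G z) (w - z)| <= L * enorm (w - z) ^+ 2.
  by rewrite (addrC z (w - z)) subrK ler_norml -enorm_sqr; lra.
apply: taylor1 => // c c01; apply: le_trans (abs_dotp_le _ _) _.
rewrite expr2 mulrA; apply: ler_wpM2r; first exact: enorm_ge0.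
apply: le_trans (lip _ _ (box_segment c01 bz bw) bz) _.
case/andP: c01 => c0 c1.
rewrite (addrC z) addrK enormZ ger0_norm // mulrA.
by apply: ler_wpM2r; [exact: enorm_ge0 | rewrite ler_piMr].
Qed.

(** Any constant strictly above the infimum will do, so its attainment need not be proved; hence the
    [l1 + 1] and [l2 + 1] of the final proof. *)
Lemma lipschitz_constant_lt d k (G : 'rV[R]_d -> 'rV[R]_k) l :
  (exists L, lipschitz_with setT G L) -> lipschitz_constant G < l ->
  lipschitz_with setT G l.
Proof.
move=> ne lt_l; have [L [Lp lip] Ll] := inf_lt ne lt_l.
split; first exact: le_trans (ltW Ll).
move=> u v _ _; apply: le_trans (lip u v I I) _.
by apply: ler_wpM2r; [exact: enorm_ge0 | exact: ltW].
Qed.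

End Calculus.

Section ProximalStep.
Variables (R : realType) (d : nat) (f : 'rV[R]_d -> \bar R).
Hypothesis f_proper : Defs.proper f.

(** Comparison with a point of the domain: values are finite after one prox step, even if [f] is
    infinite at the starting point. *)
Lemma prox_fin s p u : prox s f p u -> exists r, f u = r%:E.
Proof.
case: f_proper => fny [w fw] /(_ w).
have := fny u; case: (f u) => [r _ _|//|//]; first by exists r.
by have := fny w; case: (f w) fw.
Qed.

(** Expanding the squares in the minimality of [u'] shows that -(g + (u' - u) / s) is a proximal
    subgradient of [f] at [u'], globally and with curvature 1 / (2s). *)
Lemma prox_subgradient s g u u' r w t : 0 < s ->
  prox (1 / s) f (u - s *: g) u' -> f u' = r%:E -> f w = t%:E ->
  r - dotp (g + s^-1 *: (u' - u)) (w - u') - s^-1 / 2 * dotp (w - u') (w - u') <= t.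
Proof.
move=> s0 /(_ w) /=; move=> + Er Et; rewrite Er Et -!EFinD lee_fin !enorm_sqr.
have -> : w - (u - s *: g) = (w - u') + ((u' - u) + s *: g).
  by apply/rowP => i; rewrite !mxE; ring.
have -> : u' - (u - s *: g) = (u' - u) + s *: g.
  by apply/rowP => i; rewrite !mxE; ring.
move: (w - u') (u' - u) => D E.
rewrite !(dotpDl, dotpDr, dotpZl, dotpZr).
rewrite (dotpC E D) (dotpC g D) (dotpC g E).
set A := dotp D D; set e1 := dotp D E; set e2 := dotp D g.
move=> h.
have -> : s^-1 / 2 * A = 1 / s / 2 * A by rewrite div1r.
have k : 1 / s / 2 * (s * e2) = e2 / 2.
  by field; rewrite gt_eqF.
move: h; rewrite !mulrDr k div1r; lra.
Qed.

Variables (h : 'rV[R]_d -> R) (g : 'rV[R]_d) (rho delta amin amax alpha lambda : R).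
Variables (u u' : 'rV[R]_d).
Hypotheses (rho01 : 0 < rho < 1) (delta01 : 0 < delta < 1) (amin0 : 0 < amin).
Hypotheses (alphaI : amin <= alpha <= amax) (lambda0 : 0 < lambda).
Hypothesis descent : forall w,
  h w <= h u + dotp g (w - u) + lambda * enorm (w - u) ^+ 2.

Let P w := ((h w)%:E + f w)%E.

(** The proximal inequality at [w], tested at [u], gives f w + <g, w - u> + |w - u|^2 / (2s) <= f u.
    The descent bound costs [lambda] |w - u|^2, and the rest covers the required decrease once s is
    below the threshold. If f u is infinite, the test is trivial. *)
Lemma backtracking_accepts s w : 0 < s -> s <= (1 - delta) / (2 * lambda) ->
  prox (1 / s) f (u - s *: g) w ->
  (P w <= P u - (delta / (2 * s) * enorm (w - u) ^+ 2)%:E)%E.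
Proof.
move=> s0 sl pw; have [q Eq] := prox_fin pw.
have := f_proper.1 u; rewrite /P Eq.
case E : (f u) => [r| |//] _; last exact: leey.
have := prox_subgradient s0 pw Eq E.
rewrite -!EFinD lee_fin !enorm_sqr.
have := descent w; rewrite enorm_sqr.
have -> : u - w = - (w - u) by rewrite opprB.
move: (w - u) => D; rewrite !(dotpDl, dotpNr, dotpNl, dotpZl).
have A0 := dotp_ge0 D; set A := dotp D D in A0 *.
set c := dotp g D; move=> h1 h2.
have : lambda * A <= (1 - delta) / (2 * s) * A.
  apply: ler_wpM2r => //.
  by move: sl; rewrite !ler_pdivlMr ?mulr_gt0 //; lra.
have -> : (1 - delta) / (2 * s) = s^-1 / 2 - delta / (2 * s).
  by rewrite invfM; field; rewrite gt_eqF.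
move: h2; lra.
Qed.

(** After at least one rejection, the last rejected step size was above the acceptance threshold, so
    the accepted one is above [rho] times it. *)
Lemma backtracking_stepP : backtracking_step f P g rho delta alpha u u' ->
  exists s, [/\ Num.min amin (rho * ((1 - delta) / (2 * lambda))) <= s, s <= amax,
    prox (1 / s) f (u - s *: g) u' &
    (P u' <= P u - (delta / (2 * amax) * enorm (u' - u) ^+ 2)%:E)%E].
Proof.
move=> [i [pi acc rej]]; case/andP: rho01 => rho0 rho1; case/andP: delta01 => d0 d1.
case/andP: alphaI => al1 al2.
have al0 : 0 < alpha by exact: lt_le_trans al1.
have amax0 : 0 < amax by exact: lt_le_trans al2.
have st0 j : 0 < rho ^+ j * alpha by rewrite mulr_gt0 // exprn_gt0.
have st1 j : rho ^+ j * alpha <= amax.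
  by apply: le_trans al2; rewrite ler_piMl ?exprn_ile1 ?(ltW rho0) ?(ltW rho1) // ltW.
exists (rho ^+ i * alpha); split=> //.
  case: i pi acc rej => [|i] pi acc rej.
    by rewrite expr0 mul1r ge_min al1.
  have [w pw /negP nacc] := rej i (ltnSn i).
  rewrite ge_min; apply/orP; right; rewrite exprS -mulrA ler_wpM2l ?(ltW rho0) //.
  by rewrite leNgt; apply/negP => /ltW sl; apply: nacc; exact: backtracking_accepts.
apply: le_trans acc _; apply: leeB => //; rewrite lee_fin.
apply: ler_wpM2r; first exact: sqr_ge0.
have i0 : 0 < 2 * (rho ^+ i * alpha) by rewrite mulr_gt0.
have m0 : 0 < 2 * amax by rewrite mulr_gt0.
by rewrite (ler_pM2l d0) lef_pV2 ?posrE // (ler_pM2l (ltr0Sn _ 1)).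
Qed.

End ProximalStep.

(** * Convergence under sufficient decrease and a slope bound *)

Section Convergence.
Variable R : realType.

Lemma frechet0_of_psub N (F : 'rV[R]_N -> \bar R) M C a z :
  (forall w, (-oo < F w)%E) -> 0 <= C -> box (M - 1) z ->
  psub F M C a (row_mx z 0) -> frechet_subdiff F z 0.
Proof.
move=> Fny C0 bz [_ Fz sub]; rewrite row_mxKl row_mxKr in Fz sub.
split; first by rewrite Fz.
apply/lee_addgt0Pr => e e0.
(* The bound 1 keeps w in the box; the other gives C |w - z| <= e, with N converting the sup norm of
   the ball and + 1 keeping the denominator positive. *)
pose dl := Num.min 1 (e / (C * N%:R + 1)).
have CN : 0 < C * N%:R + 1 by rewrite ltr_wpDl // mulr_ge0.
have dl0 : 0 < dl by rewrite lt_min ltr01 divr_gt0.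
suff : ((- e)%:E <= limf_einf (fun w => (F w - F z - (dotp 0 (w - z))%:E) *
    ((enorm (w - z))^-1)%:E) z^')%E.
  by move=> /(leeD2r e%:E); rewrite -EFinD addNr.
rewrite limf_einfE; apply: le_trans (ereal_sup_ubound _); last first.
  by exists (ball z dl `\ z)%classic => //; exact: dnbhs_ball.
apply: le_ereal_inf_tmp => _ [w [[_ zw] /= wz] <-].
have wi i : `|w 0 i - z 0 i| < dl by rewrite distrC; exact: zw.
have bw : box M w.
  move=> i; have := bz i; have := wi i; have : dl <= 1 by rewrite ge_min lexx.
  by have := ler_normD (z 0 i) (w 0 i - z 0 i); rewrite addrCA subrr addr0; lra.
have d0 : 0 < enorm (w - z).
  rewrite lt_neqAle enorm_ge0 andbT eq_sym; apply/eqP => /enorm0_eq0/eqP.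
  by rewrite subr_eq0 => /eqP.
have dN : enorm (w - z) <= N%:R * dl.
  apply: le_trans (enorm_le_sum _) _.
  rewrite -[N in N%:R]card_ord -sum1_card natr_sum mulr_suml.
  by apply: ler_sum => i _; rewrite mul1r !mxE; exact: ltW.
rewrite dotp0l sube0 Fz.
case E : (F w) => [t| |]; last by have := Fny w; rewrite E.
  rewrite -EFinB -EFinM lee_fin ler_pdivlMr //.
  have := sub _ _ bw E; rewrite dotp0l addr0 -enorm_sqr expr2 mulrA.
  suff h : C * enorm (w - z) <= e.
    have : C * enorm (w - z) * enorm (w - z) <= e * enorm (w - z).
      by rewrite ler_wpM2r // ltW.
    lra.
  apply: (@le_trans _ _ (C * (N%:R * dl))); first by rewrite ler_wpM2l.
  have : dl <= e / (C * N%:R + 1) by rewrite ge_min lexx orbT.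
  by rewrite ler_pdivlMr // mulrA; lra.
by rewrite addye // gt0_mulye ?lte_fin ?invr_gt0 // leey.
Qed.

Lemma critical_of_psub N (F : 'rV[R]_N -> \bar R) M C a z :
  (forall w, (-oo < F w)%E) -> 0 <= C -> box (M - 1) z ->
  psub F M C a (row_mx z 0) -> critical_point F z.
Proof.
move=> Fny C0 bz sub; have fr := frechet0_of_psub Fny C0 bz sub.
split; first by case: fr.
by exists (fun=> z), (fun=> 0); split=> [| |//|]; exact: cvg_cst.
Qed.

Lemma cvg_coord N (z : nat -> 'rV[R]_N) (l : 'rV[R]_N) :
  (forall i, z k 0 i @[k --> \oo] --> l 0 i) -> z k @[k --> \oo] --> l.
Proof.
move=> zl; apply/cvg_ballP => e e0.
have : \forall k \near \oo, forall i, `|l 0 i - z k 0 i| < e.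
  by apply: filter_forall => i; move/cvgrPdist_lt : (zl i); exact.
by apply: filterS => k h; split=> // j i; rewrite ord1; exact: h.
Qed.

Lemma finite_length_cvg N (z : nat -> 'rV[R]_N) B :
  (forall n, \sum_(k < n) enorm (z k.+1 - z k) <= B) ->
  exists l : 'rV[R]_N, z k @[k --> \oo] --> l.
Proof.
move=> len.
have ex i : exists l : R, z k 0 i @[k --> \oo] --> l.
  have tele k : z k 0 i = z 0%N 0 i + series (fun j => z j.+1 0 i - z j 0 i) k.
    rewrite seriesEord /=; elim: k => [|k IH]; first by rewrite big_ord0 addr0.
    by rewrite big_ord_recr /= addrA -IH addrCA subrr addr0.
  have : cvgn (series (fun j => z j.+1 0 i - z j 0 i)).
    apply: normed_cvg; apply: nondecreasing_is_cvgn.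
      by apply: nondecreasing_series => k _ _; exact: normr_ge0.
    exists B => _ [k _ <-]; rewrite /normed_series_of seriesEord /=; apply: le_trans (len k).
    by apply: ler_sum => j _; have := enorm_coord (z j.+1 - z j) i; rewrite !mxE.
  move=> /cvg_ex[l sl]; exists (z 0%N 0 i + l).
  by under eq_fun do rewrite tele; apply: cvgD => //; exact: cvg_cst.
have [l lP] := choice ex.
by exists (\row_i l i); apply: cvg_coord => i; rewrite mxE.
Qed.

Variables (N : nat) (F : 'rV[R]_N -> \bar R) (M C b c lo : R).
Variables (z v : nat -> 'rV[R]_N) (Phi : nat -> R).
Hypothesis F_sa : semialgebraic F.
Hypothesis F_closed : forall r, closed [set z | (F z <= r%:E)%E].
Hypothesis F_ninfty : forall z, (-oo < F z)%E.
Hypotheses (C0 : 0 <= C) (b0 : 0 <= b) (c0 : 0 < c).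
Hypothesis F_z : forall k, F (z k) = (Phi k)%:E.
Hypothesis Phi_lo : forall k, lo <= Phi k.
Hypothesis z_box : forall k, box (M - 1) (z k).
Hypothesis decrease : forall k, Phi k.+1 <= Phi k - c * enorm (z k.+1 - z k) ^+ 2.
Hypothesis subgrad : forall k, psub F M C (Phi k.+1) (row_mx (z k.+1) (v k.+1)).
Hypothesis slope : forall k, enorm (v k.+1) <= b * enorm (z k.+1 - z k).

Let D k := enorm (z k.+1 - z k).
Let a := inf (range Phi).

Lemma Phi_has_inf : has_inf (range Phi).
Proof. by split; [exists (Phi 0%N), 0%N | exists lo => _ [k _ <-]]. Qed.

Lemma Phi_ge_inf k : a <= Phi k.
Proof. by apply: ge_inf; [exact: Phi_has_inf.2 | exists k]. Qed.

Lemma Phi_noninc j k : (j <= k)%N -> Phi k <= Phi j.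
Proof.
elim: k => [|k IH]; first by rewrite leqn0 => /eqP ->.
rewrite leq_eqVlt => /predU1P[->//|/IH]; apply: le_trans.
by apply: le_trans (decrease k) _; rewrite gerBl mulr_ge0 ?sqr_ge0 // ltW.
Qed.

Lemma Phi_near e : 0 < e -> exists k, Phi k < a + e.
Proof. by move=> /inf_adherent/(_ Phi_has_inf)[_ [k _ <-] ?]; exists k. Qed.

Lemma step_small k : c * D k ^+ 2 <= Phi k - a.
Proof. by have := decrease k; have := Phi_ge_inf k.+1; rewrite -/(D k); lra. Qed.

(** |v|^2 is at most b^2 / c times the gap [Phi k - a], which tends to 0. *)
Lemma slope_small e : 0 < e -> exists k0, forall k, (k0 <= k)%N -> enorm (v k.+1) ^+ 2 < e.
Proof.
move=> e0; have b1 : 0 < b ^+ 2 + 1 by rewrite ltr_wpDl ?sqr_ge0.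
have [k0 hk0] := Phi_near (divr_gt0 (mulr_gt0 e0 c0) b1).
exists k0 => k k0k.
have h1 : enorm (v k.+1) ^+ 2 <= b ^+ 2 * D k ^+ 2.
  by rewrite -exprMn ler_pXn2r ?slope // nnegrE ?mulr_ge0 ?enorm_ge0.
have h2 : (Phi k - a) * (b ^+ 2 + 1) < e * c.
  by rewrite -ltr_pdivlMr // ltrBlDl; exact: le_lt_trans (Phi_noninc k0k) hk0.
rewrite -(ltr_pM2r c0).
have h3 := step_small k.
have h4 : b ^+ 2 * (c * D k ^+ 2) <= b ^+ 2 * (Phi k - a).
  by rewrite ler_wpM2l ?sqr_ge0.
have h5 : c * enorm (v k.+1) ^+ 2 <= c * (b ^+ 2 * D k ^+ 2) by rewrite ler_pM2l.
have := Phi_ge_inf k; lra.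
Qed.

Lemma tail_length : exists K B, forall n, \sum_(j < n) D (K + j) <= B.
Proof.
(* The inequality is available only at levels strictly above [a]. If [a] is attained, sufficient
   decrease makes the sequence stationary. *)
have [[K PK]|npos] := pselect (exists K, Phi K = a).
  exists K, 0 => n; rewrite big1 // => j _.
  have : c * D (K + j) ^+ 2 <= 0.
    apply: le_trans (step_small _) _; rewrite subr_le0 -PK.
    by apply: Phi_noninc; rewrite leq_addr.
  by rewrite pmulr_rle0 // exprn_even_le0 //= => /eqP.
have pos k : a < Phi k.
  by rewrite lt_neqAle Phi_ge_inf andbT; apply/eqP => e; apply: npos; exists k.
have crit e b' : 0 < e -> a < b' ->
    exists r u, [/\ a < r < b', psub F M C r u & slope2 u < e].
  move=> e0 ab'.
  have [k0 hk0] := slope_small e0.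
  have [k1 hk1] : exists k, Phi k < a + (b' - a) by apply: Phi_near; rewrite subr_gt0.
  pose k := maxn k0 k1.
  exists (Phi k.+1), (row_mx (z k.+1) (v k.+1)); split=> //.
    rewrite pos /=; apply: le_lt_trans (Phi_noninc (_ : (k1 <= _)%N)) _.
      by rewrite ltnW // ltnS leq_maxr.
    by move: hk1; rewrite addrCA subrr addr0.
  by rewrite /slope2 row_mxKr -enorm_sqr hk0 // leq_maxl.
have [b' [phi [B [ab' phiB phi_mono kl]]]] :=
  integrated_KL F_sa F_closed F_ninfty C0 crit.
have [K hK] : exists k, Phi k < a + (b' - a) by apply: Phi_near; rewrite subr_gt0.
move: hK; rewrite addrCA subrr addr0 => hK.
have Pb k : (K <= k)%N -> Phi k < b' by move=> /Phi_noninc /le_lt_trans; exact.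
have rec k : (K <= k)%N ->
    2 * D k.+1 <= D k + b / c * (phi (Phi k.+1) - phi (Phi k.+2)).
  move=> Kk; have Kk1 : (K <= k.+1)%N by exact: leqW.
  have PP : Phi k.+2 <= Phi k.+1 by exact: Phi_noninc.
  have h := kl _ _ _ (pos k.+2) PP (Pb _ Kk1) (subgrad k).
  rewrite row_mxKr in h.
  have ph := phi_mono _ _ (pos k.+2) PP (Pb _ Kk1).
  set X := b / c * _.
  have X0 : 0 <= X by rewrite mulr_ge0 ?subr_ge0 // divr_ge0 // ltW.
  have D0 : 0 <= D k by exact: enorm_ge0.
  have D1 : 0 <= D k.+1 by exact: enorm_ge0.
  (* AM-GM turns D_(k+1)^2 <= D_k X into a telescoping bound. *)
  have DX : D k.+1 ^+ 2 <= D k * X.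
    rewrite -(ler_pM2l c0); apply: (@le_trans _ _ (Phi k.+1 - Phi k.+2)).
      by have := decrease k.+1; rewrite -/(D k.+1); lra.
    apply: le_trans h _.
    have -> : c * (D k * X) = (b * D k) * (phi (Phi k.+1) - phi (Phi k.+2)).
      by rewrite /X; field; rewrite gt_eqF.
    by apply: ler_wpM2r; [rewrite subr_ge0 | exact: slope].
  clearbody X; rewrite -(@ler_pXn2r _ 2) ?nnegrE ?addr_ge0 ?mulr_ge0 //.
  by have := sqr_ge0 (D k - X); move: DX; rewrite exprMn !expr2; lra.
have bc0 : 0 <= b / c by rewrite divr_ge0 // ltW.
exists K.+1; exists (D K + b / c * (B + B)) => n.
(* Summing [rec] telescopes twice: in phi, and in D, where the term on the right cancels one of the
   two copies on the left. *)
have key : \sum_(j < n) D (K.+1 + j) + D (K + n) <=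
    D K + b / c * (phi (Phi K.+1) - phi (Phi (K.+1 + n))).
  elim: n => [|n IH]; first by rewrite big_ord0 add0r !addn0 subrr mulr0 addr0.
  rewrite big_ord_recr /=; have := rec (K + n)%N (leq_addr _ _).
  by rewrite !addSn !addnS; lra.
have Dn : 0 <= D (K + n) by exact: enorm_ge0.
have h1 : `|phi (Phi K.+1)| <= B by apply: phiB; rewrite pos Pb.
have h2 : `|phi (Phi (K.+1 + n))| <= B.
  by apply: phiB; rewrite pos Pb // addSn leqW // leq_addr.
have : b / c * (phi (Phi K.+1) - phi (Phi (K.+1 + n))) <= b / c * (B + B).
  by apply: ler_wpM2l => //; move: h1 h2; rewrite !ler_norml; lra.
lra.
Qed.

Lemma bounded_length : exists B, forall n, \sum_(k < n) D k <= B.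
Proof.
have [K [B hB]] := tail_length.
exists (\sum_(k < K) D k + B) => n.
have D0 k : 0 <= D k by exact: enorm_ge0.
apply: (@le_trans _ _ (\sum_(k < K + n) D k)).
  rewrite addnC big_split_ord /= lerDl; exact: sumr_ge0.
by rewrite big_split_ord /= lerD2l; exact: hB.
Qed.

Lemma limit_critical : exists2 l : 'rV[R]_N, z k @[k --> \oo] --> l & critical_point F l.
Proof.
have [B hB] := bounded_length; have [l zl] := finite_length_cvg hB.
exists l => //.
have zl1 : z k.+1 @[k --> \oo] --> l by rewrite cvg_shiftS.
have bl : box (M - 1) l.
  apply: (closed_cvg _ (@closed_box _ _ _) _ l zl).
  by near=> k; exact: z_box.
have vl : v k.+1 @[k --> \oo] --> (0 : 'rV[R]_N).
  apply: cvg_coord => i; rewrite mxE; apply/cvgrPdist_lt => e e0.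
  have [k0 hk0] := slope_small (exprn_gt0 2 e0).
  exists k0 => //= k /hk0; rewrite sub0r normrN ltr_pXn2r ?nnegrE ?enorm_ge0 ?ltW //.
  exact: le_lt_trans (enorm_coord _ _).
have ul : row_mx (z k.+1) (v k.+1) @[k --> \oo] --> (row_mx l 0 : 'rV[R]_(N + N)).
  apply: cvg_coord => i; rewrite -[i]splitK; case: (fintype.split i) => j /=.
    rewrite row_mxEl; under eq_fun do rewrite row_mxEl.
    exact: (cvg_comp _ _ zl1 (@coord_continuous _ _ _ 0 j l)).
  rewrite row_mxEr; under eq_fun do rewrite row_mxEr.
  exact: (cvg_comp _ _ vl (@coord_continuous _ _ _ 0 j 0)).
have Fl k : (F l <= (Phi k)%:E)%E.
  apply: (closed_cvg _ (@F_closed (Phi k)) _ l zl).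
  by exists k => //= j kj; rewrite F_z lee_fin Phi_noninc.
have bM : box M l by move=> i; apply: le_trans (bl i) _; lra.
(* [Phi k.+1] is first lowered to the constant [a]; what remains is continuous in the pair, so the
   inequality passes to the limit with subgradient 0. *)
have ineq w t : box M w -> F w = t%:E ->
    a + dotp 0 (w - l) - C * dotp (w - l) (w - l) <= t.
  move=> bw Fw.
  have ccst (U : topologicalType) (y : U) : continuous (fun _ : 'rV[R]_(N + N) => y).
    by move=> x; exact: cst_continuous.
  have cw : continuous (fun u : 'rV[R]_(N + N) => w - lsubmx u).
    by move=> u; exact: (continuousB (@ccst _ w u) (@lsubmx_continuous _ _ _ u)).
  have c1 := dotp_continuous (@rsubmx_continuous R N N) cw.
  have c2 := dotp_continuous cw cw.
  pose G (u : 'rV[R]_(N + N)) := a + dotp (rsubmx u) (w - lsubmx u) -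
    C * dotp (w - lsubmx u) (w - lsubmx u).
  have cG : continuous G.
    move=> u; exact: (continuousB (continuousD (@ccst _ a u) (c1 u))
      (continuousM (@ccst _ C u) (c2 u))).
  suff : [set u | G u <= t] (row_mx l 0) by rewrite /= /G row_mxKl row_mxKr.
  apply: (closed_cvg _ (closed_le_fun (y := t) cG) _ (row_mx l 0) ul).
  near=> k; rewrite /= /G; have [_ _ /(_ _ _ bw Fw)] := subgrad k; apply: le_trans.
  by rewrite lerD2r lerD2r; exact: Phi_ge_inf.
apply: (critical_of_psub F_ninfty C0 bl (C := C) (a := a)).
rewrite /psub /= row_mxKl row_mxKr; split=> //.
(* The value at the limit is exactly [a]: closed sublevels give F l <= a, and the limit inequality
   at w = l gives a <= F l. *)
have := F_ninfty l; case E : (F l) => [t| |] // _; last by have := Fl 0%N; rewrite E.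
congr (_%:E); apply/eqP; rewrite eq_le; apply/andP; split.
  apply: lb_le_inf; first exact: Phi_has_inf.1.
  by move=> _ [k _ <-]; rewrite -lee_fin -E.
by have := ineq _ _ bM E; rewrite subrr !dotp0r mulr0 addr0 subr0.
Unshelve. all: by end_near. Qed.

End Convergence.

(** * The sPALM iterates *)

Section LowerSemicontinuity.
Variable R : realType.

Lemma lte_addP (a : R) (u v : \bar R) : (-oo < u)%E -> (-oo < v)%E ->
  (a%:E < u + v)%E ->
  exists b c : R, [/\ (b%:E < u)%E, (c%:E < v)%E & a <= b + c].
Proof.
case: u => [r| |] //; case: v => [s| |] // _ _.
- rewrite -EFinD lte_fin => ars.
  exists (r - (r + s - a) / 2), (s - (r + s - a) / 2).
  by rewrite !lte_fin; split; lra.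
- by move=> _; exists (r - 1), (a - (r - 1)); rewrite lte_fin ltry; split=> //; lra.
- by move=> _; exists (a - (s - 1)), (s - 1); rewrite lte_fin ltry; split=> //; lra.
- by move=> _; exists a, 0; rewrite !ltry addr0.
Qed.

Lemma lsc_add (T : topologicalType) (f g : T -> \bar R) :
  (forall z, -oo < f z)%E -> (forall z, -oo < g z)%E ->
  lower_semicontinuous f -> lower_semicontinuous g ->
  lower_semicontinuous (fun z => f z + g z)%E.
Proof.
move=> fny gny lf lg z a /(lte_addP (fny z) (gny z))[b [c [bf cg abc]]].
have [V zV Vf] := lf _ _ bf; have [W zW Wg] := lg _ _ cg.
exists (V `&` W); first exact: filterI.
move=> y [/Vf fy /Wg gy]; apply: le_lt_trans (lteD fy gy).
by rewrite -EFinD lee_fin.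
Qed.

Lemma lsc_comp (T U : topologicalType) (c : T -> U) (f : U -> \bar R) :
  continuous c -> lower_semicontinuous f -> lower_semicontinuous (f \o c).
Proof.
by move=> cc lf z a /lf[V zV Vf]; exists (c @^-1` V); [exact: cc | move=> y /Vf].
Qed.

Lemma lsc_continuous (T : topologicalType) (h : T -> R) :
  continuous h -> lower_semicontinuous (fun z => (h z)%:E).
Proof.
move=> ch z a; rewrite lte_fin => az; exists (h @^-1` [set t | a < t]).
  by apply: ch; exact: lt_nbhsr.
by move=> y /=; rewrite lte_fin.
Qed.

Lemma lsc_closed (T : topologicalType) (f : T -> \bar R) r :
  lower_semicontinuous f -> closed [set z | (f z <= r%:E)%E].
Proof.
move=> /lower_semicontinuousP/(_ r) /open_closedC; congr closed.
by apply/seteqP; split=> z /=; rewrite leNgt => /negP.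
Qed.

End LowerSemicontinuity.

(** * Curvature and slope bounds for one alternating iteration *)

Section PALM.
Variables (R : realType) (n m : nat) (H : 'rV[R]_n -> 'rV[R]_m -> R).
Variables (f1 : 'rV[R]_n -> \bar R) (f2 : 'rV[R]_m -> \bar R).
Hypotheses (f1_proper : Defs.proper f1) (f2_proper : Defs.proper f2).

Lemma Psi_ninfty z : (-oo < Psi H f1 f2 z)%E.
Proof.
rewrite /Psi; have := f1_proper.1 (lsubmx z); have := f2_proper.1 (rsubmx z).
by case: (f1 _) => [?| |] //; case: (f2 _) => [?| |] //= _ _; rewrite -?EFinD ?ltNyr.
Qed.

Lemma Psi_row_mx x y p q : f1 x = p%:E -> f2 y = q%:E ->
  Psi H f1 f2 (row_mx x y) = (H x y + p + q)%:E.
Proof. by rewrite /Psi /joint row_mxKl row_mxKr => -> ->. Qed.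

Lemma Psi_fin z t : Psi H f1 f2 z = t%:E -> exists p q,
  [/\ f1 (lsubmx z) = p%:E, f2 (rsubmx z) = q%:E & t = joint H z + p + q].
Proof.
rewrite /Psi; have := f1_proper.1 (lsubmx z); have := f2_proper.1 (rsubmx z).
by case: (f1 _) => [p| |] //; case: (f2 _) => [q| |] //= _ _ [<-]; exists p, q.
Qed.

Lemma Psi_closed r : lower_semicontinuous f1 -> lower_semicontinuous f2 ->
  (forall z, differentiable (joint H) z) ->
  closed [set z | (Psi H f1 f2 z <= r%:E)%E].
Proof.
move=> l1 l2 dH; apply: lsc_closed.
apply: (@lsc_add _ _ (fun z => (joint H z)%:E + f1 (lsubmx z))%E (f2 \o rsubmx)).
- move=> z /=; have := f1_proper.1 (lsubmx z).
  by case: (f1 _) => [?| |] //= _; rewrite -EFinD ltNyr.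
- by move=> z; exact: f2_proper.1.
- apply: (@lsc_add _ _ (fun z => (joint H z)%:E) (f1 \o lsubmx)).
  + by move=> z; exact: ltNyr.
  + by move=> z; exact: f1_proper.1.
  + by apply: lsc_continuous => z; exact: differentiable_continuous.
  + by apply: lsc_comp => //; exact: lsubmx_continuous.
- by apply: lsc_comp => //; exact: rsubmx_continuous.
Qed.

Variables (M L s1 s2 : R) (x x' : 'rV[R]_n) (y y' : 'rV[R]_m).
Hypotheses (dH : forall z, differentiable (joint H) z).
Hypothesis lipH : lipschitz_with (box M) (grad (joint H)) L.
Hypotheses (s1_gt0 : 0 < s1) (s2_gt0 : 0 < s2).

(** The gradient of [H] at the new point plus the subgradients of [f1] and [f2] left by the two prox
    steps. The y-step already uses [x'], whence [grady H x' y]. *)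
Definition palm_slope : 'rV[R]_(n + m) :=
  grad (joint H) (row_mx x' y') -
  row_mx (gradx H x y + s1^-1 *: (x' - x)) (grady H x' y + s2^-1 *: (y' - y)).

(** Sum of three quadratic lower bounds: two from the prox steps and one from [H] on the box. The
    bound on C is a crude majorant of the curvatures in both blocks. *)
Lemma palm_psub C p q : box M (row_mx x' y') ->
  prox (1 / s1) f1 (x - s1 *: gradx H x y) x' -> f1 x' = p%:E ->
  prox (1 / s2) f2 (y - s2 *: grady H x' y) y' -> f2 y' = q%:E ->
  L + s1^-1 + s2^-1 <= C ->
  psub (Psi H f1 f2) M C (H x' y' + p + q) (row_mx (row_mx x' y') palm_slope).
Proof.
move=> bz px Ep py Eq LC; rewrite /psub /= !row_mxKl !row_mxKr; split=> //.
  exact: Psi_row_mx.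
move=> w t bw /Psi_fin[t1 [t2 [E1 E2 ->]]].
have h1 := prox_subgradient s1_gt0 px Ep E1.
have h2 := prox_subgradient s2_gt0 py Eq E2.
have h3 := lower_quadratic_box dH lipH bz bw.
have Hz : joint H (row_mx x' y') = H x' y' by rewrite /joint row_mxKl row_mxKr.
have wE : w - row_mx x' y' = row_mx (lsubmx w - x') (rsubmx w - y').
  by rewrite -{1}[w]hsubmxK opp_row_mx add_row_mx.
rewrite /palm_slope dotpDl dotpNl.
move: h1 h2 h3; rewrite Hz wE !dotp_row_mx.
have d1 := dotp_ge0 (lsubmx w - x'); have d2 := dotp_ge0 (rsubmx w - y').
set D1 := dotp _ _ in d1 *; set D2 := dotp _ _ in d2 *.
set G := dotp (grad _ _) _; move=> h1 h2 h3.
have i1 : 0 < s1^-1 by rewrite invr_gt0.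
have i2 : 0 < s2^-1 by rewrite invr_gt0.
have h4 : (L + s1^-1 + s2^-1) * (D1 + D2) <= C * (D1 + D2).
  by rewrite ler_wpM2r // addr_ge0.
have h5 := mulr_ge0 (ltW i1) d1; have h6 := mulr_ge0 (ltW i1) d2.
have h7 := mulr_ge0 (ltW i2) d1; have h8 := mulr_ge0 (ltW i2) d2.
lra.
Qed.

Lemma palm_slope_le a1 a2 :
  box M (row_mx x y) -> box M (row_mx x' y') -> 0 < a1 -> 0 < a2 ->
  a1 <= s1 -> a2 <= s2 ->
  enorm palm_slope <= (2 * L + a1^-1 + a2^-1) * enorm (row_mx x' y' - row_mx x y).
Proof.
move=> bz bz' a1p a2p as1 as2; have [L0 lip] := lipH.
set E := enorm (row_mx x' y' - row_mx x y).
have E0 : 0 <= E by exact: enorm_ge0.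
(* The box is a product, so it contains the intermediate point (x', y) through which the y-gradients
   are compared. *)
have bm : box M (row_mx x' y).
  move=> i; rewrite -[i]splitK; case: (fintype.split i) => j /=.
    by have := bz' (lshift m j); rewrite !row_mxEl.
  by have := bz (rshift n j); rewrite !row_mxEr.
have EE : E = enorm (row_mx (x' - x) (y' - y)).
  by rewrite /E opp_row_mx add_row_mx.
have ix : enorm (x' - x) <= E by rewrite EE; exact: enorm_row_mxl.
have iy : enorm (y' - y) <= E by rewrite EE; exact: enorm_row_mxr.
have g1 : enorm (gradx H x' y' - gradx H x y) <= L * E.
  apply: le_trans (lip _ _ bz' bz).
  by rewrite !grad_joint opp_row_mx add_row_mx; exact: enorm_row_mxl.
have g2 : enorm (grady H x' y' - grady H x' y) <= L * E.
  apply: (@le_trans _ _ (L * enorm (row_mx x' y' - row_mx x' y))).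
    apply: le_trans (lip _ _ bz' bm).
    by rewrite !grad_joint opp_row_mx add_row_mx; exact: enorm_row_mxr.
  apply: ler_wpM2l => //; rewrite opp_row_mx add_row_mx subrr.
  apply: le_trans (enorm_row_mx_le _ _) _.
  by rewrite enorm0 add0r.
have inv (a s : R) : 0 < a -> a <= s -> 0 <= s^-1 <= a^-1.
  move=> a0 as_; have s0 : 0 < s by exact: lt_le_trans as_.
  by rewrite invr_ge0 (ltW s0) lef_pV2 ?posrE.
have /andP[j1 k1] := inv _ _ a1p as1; have /andP[j2 k2] := inv _ _ a2p as2.
have t1 : enorm (s1^-1 *: (x' - x)) <= a1^-1 * E.
  by rewrite enormZ ger0_norm // ler_pM ?enorm_ge0.
have t2 : enorm (s2^-1 *: (y' - y)) <= a2^-1 * E.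
  by rewrite enormZ ger0_norm // ler_pM ?enorm_ge0.
rewrite /palm_slope grad_joint opp_row_mx add_row_mx !opprD !addrA.
apply: le_trans (enorm_row_mx_le _ _) _.
have u1 := enormD (gradx H x' y' - gradx H x y) (- (s1^-1 *: (x' - x))).
have u2 := enormD (grady H x' y' - grady H x' y) (- (s2^-1 *: (y' - y))).
rewrite !enormN in u1 u2; lra.
Qed.

End PALM.

Lemma nneseries_lt_pinfty (R : realType) (D : nat -> R) (N : nat) (B : R) :
  (forall k, 0 <= D k) -> (forall n, \sum_(k < n) D (N + k)%N <= B) ->
  (\sum_(N <= k <oo) (D k)%:E < +oo)%E.
Proof.
move=> D0 DB; apply: (@le_lt_trans _ _ B%:E); last exact: ltry.
apply: lime_le; first by apply: is_cvg_nneseries => k _ _; rewrite lee_fin.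
near=> k; rewrite sumEFin lee_fin -{1}[N]add0n big_addn big_mkord.
by under eq_bigr do rewrite addnC; exact: DB.
Unshelve. all: by end_near. Qed.

Lemma box_of_bounded (R : realType) d (z : nat -> 'rV[R]_d) :
  bounded_set (range z) -> exists2 M, 0 < M & forall k, box M (z k).
Proof.
move=> /pinfty_ex_gt0[M M0 zM]; exists M => // k i.
apply: le_trans (zM (z k) _); last by exists k.
by rewrite [leRHS]/Num.norm /= mx_normrE; apply/bigmax_geP; right; exists (ord0, i).
Qed.

Theorem theorem4p2 (R : realType) (n m : nat)
    (H : 'rV[R]_n -> 'rV[R]_m -> R)
    (f1 : 'rV[R]_n -> \bar R) (f2 : 'rV[R]_m -> \bar R)
    (rho1 delta1 rho2 delta2 amin amax : R)
    (x : nat -> 'rV[R]_n) (y : nat -> 'rV[R]_m) (alpha1 alpha2 : nat -> R)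
    (hrho1 : 0 < rho1 < 1) (hdelta1 : 0 < delta1 < 1)
    (hrho2 : 0 < rho2 < 1) (hdelta2 : 0 < delta2 < 1)
    (hamin : 0 < amin) (hamax : amin <= amax)
    (z := fun k => row_mx (x k) (y k))
    (hPsi : semialgebraic (Psi H f1 f2))
    (hA : assumptionA H f1 f2 x y)
    (hgen : sPALM H f1 f2 rho1 delta1 rho2 delta2 amin amax x y alpha1 alpha2)
    (hbnd : bounded_set (range z)) :
  (\sum_(1 <= k <oo) (enorm (z k.+1 - z k))%:E < +oo)%E /\
  exists zstar : 'rV[R]_(n + m),
    z k @[k --> \oo] --> zstar /\ critical_point (Psi H f1 f2) zstar.
Proof.
case: hA => -[f1p f1l _] [f2p f2l _] [[dH _] Psi_lo] lipH lipx lipy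
  [l1 [l2 [l1p l2p L1l L2l]]].
have lx k : lipschitz_with setT (fun u => gradx H u (y k)) (l1 + 1).
  apply: lipschitz_constant_lt (lipx _) _.
  apply: (@le_lt_trans _ _ l1); last by rewrite ltrDl.
  rewrite -lee_fin; apply: le_trans L1l; apply: ereal_sup_ubound.
  by exists k.
have ly k : lipschitz_with setT (fun v => grady H (x k) v) (l2 + 1).
  apply: lipschitz_constant_lt (lipy _) _.
  apply: (@le_lt_trans _ _ l2); last by rewrite ltrDl.
  rewrite -lee_fin; apply: le_trans L2l; apply: ereal_sup_ubound.
  by exists k.
have l1p1 : 0 < l1 + 1 by rewrite addr_gt0.
have l2p1 : 0 < l2 + 1 by rewrite addr_gt0.
pose a1 := Num.min amin (rho1 * ((1 - delta1) / (2 * (l1 + 1)))).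
pose a2 := Num.min amin (rho2 * ((1 - delta2) / (2 * (l2 + 1)))).
have amax0 : 0 < amax by exact: lt_le_trans hamax.
have a1p : 0 < a1.
  case/andP: hrho1 => r0 _; case/andP: hdelta1 => _ d1.
  by rewrite lt_min hamin mulr_gt0 // divr_gt0 ?subr_gt0 // mulr_gt0.
have a2p : 0 < a2.
  case/andP: hrho2 => r0 _; case/andP: hdelta2 => _ d1.
  by rewrite lt_min hamin mulr_gt0 // divr_gt0 ?subr_gt0 // mulr_gt0.
have [s1 s1P] : exists s : nat -> R, forall k, [/\ a1 <= s k, s k <= amax,
    prox (1 / s k) f1 (x k - s k *: gradx H (x k) (y k)) (x k.+1) &
    (Psi1 H f1 (x k.+1) (y k) <= Psi1 H f1 (x k) (y k) -
      (delta1 / (2 * amax) * enorm (x k.+1 - x k) ^+ 2)%:E)%E].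
  suff ex k : exists s : R, [/\ a1 <= s, s <= amax,
      prox (1 / s) f1 (x k - s *: gradx H (x k) (y k)) (x k.+1) &
      (Psi1 H f1 (x k.+1) (y k) <= Psi1 H f1 (x k) (y k) -
        (delta1 / (2 * amax) * enorm (x k.+1 - x k) ^+ 2)%:E)%E].
    by have [s sP] := choice ex; exists s.
  apply: (backtracking_stepP f1p (h := fun w => H w (y k)) hrho1 hdelta1 hamin
    (sPALM_alpha1_range hgen k) l1p1) (sPALM_x hgen k) => w.
  by apply: descent_x => //; exact: lx.
have [s2 s2P] : exists s : nat -> R, forall k, [/\ a2 <= s k, s k <= amax,
    prox (1 / s k) f2 (y k - s k *: grady H (x k.+1) (y k)) (y k.+1) &
    (Psi2 H f2 (x k.+1) (y k.+1) <= Psi2 H f2 (x k.+1) (y k) -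
      (delta2 / (2 * amax) * enorm (y k.+1 - y k) ^+ 2)%:E)%E].
  suff ex k : exists s : R, [/\ a2 <= s, s <= amax,
      prox (1 / s) f2 (y k - s *: grady H (x k.+1) (y k)) (y k.+1) &
      (Psi2 H f2 (x k.+1) (y k.+1) <= Psi2 H f2 (x k.+1) (y k) -
        (delta2 / (2 * amax) * enorm (y k.+1 - y k) ^+ 2)%:E)%E].
    by have [s sP] := choice ex; exists s.
  apply: (backtracking_stepP f2p (h := fun w => H (x k.+1) w) hrho2 hdelta2 hamin
    (sPALM_alpha2_range hgen k) l2p1) (sPALM_y hgen k) => w.
  by apply: descent_y => //; exact: ly.
have [p pE] : exists p : nat -> R, forall k, f1 (x k.+1) = (p k)%:E.
  suff ex k : exists r : R, f1 (x k.+1) = r%:E by have [p pP] := choice ex; exists p.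
  by have [_ _ px _] := s1P k; exact: (prox_fin f1p px).
have [q qE] : exists q : nat -> R, forall k, f2 (y k.+1) = (q k)%:E.
  suff ex k : exists r : R, f2 (y k.+1) = r%:E by have [q qP] := choice ex; exists q.
  by have [_ _ py _] := s2P k; exact: (prox_fin f2p py).
(* Shifted by one: Psi may be infinite at the initial point, so the abstract convergence result is
   applied to the sequence from [z 1] on. *)
pose Phi k := H (x k.+1) (y k.+1) + p k + q k.
have Psi_z k : Psi H f1 f2 (z k.+1) = (Phi k)%:E by exact: Psi_row_mx.
have [lo loP] : exists lo, forall k, lo <= Phi k.
  move: Psi_lo; have inf_le k : (ereal_inf (range (Psi H f1 f2)) <= (Phi k)%:E)%E.
    by apply: ereal_inf_lbound; exists (z k.+1).
  case E : (ereal_inf _) inf_le => [lo| |] // inf_le _; last by have := inf_le 0%N.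
  by exists lo => k; rewrite -lee_fin.
have [M0 M0p zM0] := box_of_bounded hbnd.
(* The margin of 1 keeps limits of the sequence in the interior of the box. *)
pose M := M0 + 1.
have zM k : box M (z k) by move=> i; apply: le_trans (zM0 k i) _; rewrite lerDl.
have [L lipL] := lipH _ (compact_bounded (@box_compact R (n + m) M)).
have L0 : 0 <= L by case: lipL.
(* Accepted step sizes are at least [a1] and [a2], so these constants hold for every iteration. *)
pose C := L + a1^-1 + a2^-1.
pose b := 2 * L + a1^-1 + a2^-1.
have i1 : 0 < a1^-1 by rewrite invr_gt0.
have i2 : 0 < a2^-1 by rewrite invr_gt0.
have s1_gt0 k : 0 < s1 k by have [h _ _ _] := s1P k; exact: lt_le_trans h.
have s2_gt0 k : 0 < s2 k by have [h _ _ _] := s2P k; exact: lt_le_trans h.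
pose v k := palm_slope H (s1 k) (s2 k) (x k) (x k.+1) (y k) (y k.+1).
pose c := Num.min delta1 delta2 / (2 * amax).
have c0 : 0 < c.
  rewrite divr_gt0 ?mulr_gt0 // lt_min.
  by case/andP: hdelta1 => -> _; case/andP: hdelta2.
have decr k : Phi k.+1 <= Phi k - c * enorm (z k.+2 - z k.+1) ^+ 2.
  have [_ _ _] := s1P k.+1; have [_ _ _] := s2P k.+1.
  rewrite /Psi1 /Psi2 !pE !qE -!EFinD !lee_fin.
  have -> : z k.+2 - z k.+1 = row_mx (x k.+2 - x k.+1) (y k.+2 - y k.+1).
    by rewrite opp_row_mx add_row_mx.
  rewrite !enorm_sqr dotp_row_mx => h2 h1.
  have m1 : c * dotp (x k.+2 - x k.+1) (x k.+2 - x k.+1) <=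
      delta1 / (2 * amax) * dotp (x k.+2 - x k.+1) (x k.+2 - x k.+1).
    by rewrite ler_wpM2r ?dotp_ge0 // ler_pM2r ?invr_gt0 ?mulr_gt0 // ge_min lexx.
  have m2 : c * dotp (y k.+2 - y k.+1) (y k.+2 - y k.+1) <=
      delta2 / (2 * amax) * dotp (y k.+2 - y k.+1) (y k.+2 - y k.+1).
    by rewrite ler_wpM2r ?dotp_ge0 // ler_pM2r ?invr_gt0 ?mulr_gt0 // ge_min lexx orbT.
  by rewrite /Phi; lra.
have inv_le (s a : R) : 0 < a -> a <= s -> s^-1 <= a^-1.
  by move=> ap as_; rewrite lef_pV2 ?posrE //; exact: lt_le_trans as_.
have sub k : psub (Psi H f1 f2) M C (Phi k.+1) (row_mx (z k.+2) (v k.+1)).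
  have [as1 _ px _] := s1P k.+1; have [as2 _ py _] := s2P k.+1.
  apply: (palm_psub f1p f2p dH lipL (s1_gt0 _) (s2_gt0 _) (zM _) px _ py) => //.
  by apply: lerD; [rewrite lerD2l|]; exact: inv_le.
have slope k : enorm (v k.+1) <= b * enorm (z k.+2 - z k.+1).
  have [as1 _ _ _] := s1P k.+1; have [as2 _ _ _] := s2P k.+1.
  by apply: (palm_slope_le lipL) => //; exact: zM.
have cl r := Psi_closed f1p f2p (r := r) f1l f2l dH.
have C0 : 0 <= C by rewrite /C !addr_ge0 // ltW.
have b0 : 0 <= b by rewrite /b !addr_ge0 ?mulr_ge0 // ltW.
have zM' k : box (M - 1) (z k.+1) by rewrite addrK.
have ny := Psi_ninfty H f1p f2p.
split.
  have [B BP] := bounded_length hPsi cl ny C0 b0 c0 loP decr sub slope.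
  by apply: (nneseries_lt_pinfty (B := B)) => [k|n']; [exact: enorm_ge0 | exact: BP].
have [l zl crit] := limit_critical hPsi cl ny C0 b0 c0 Psi_z loP zM' decr sub slope.
by exists l; split=> //; move: zl; rewrite (cvg_shiftS z).
Qed.
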